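(* Let $X\subset \mathbb{R}^n$ be a connected unbounded domain with $C^2$ smooth boundary, and let $\nu$ be the outward unit normal of $X$ along $\partial X$. Assume $X$ is mean convex on $\partial X$, i.e. $H\ge 0$ on $\partial X$. If $\partial X$ is disconnected, then for every connected component $\Sigma\subset \partial X$, \[ \inf_{\Sigma} H=0. \] In particular, no connected component of $\partial X$ has mean curvature separated away from $0$ (i.e. there is no connected component $\Sigma$ and constant $c>0$ with $H\ge c$ on $\Sigma$).
   Context: A domain with $C^2$ smooth boundary is an open subset of $\mathbb{R}^n$ whose boundary $\partial X$ is a $C^2$ embedded hypersurface with $X$ lying locally on one side of it. The second fundamental form $h$ of $\partial X$ is taken with respect to the outward unit normal $\nu$, with the sign convention that for a geodesic $\alpha$ of $\partial X$ with $\alpha(0)=p$, $\alpha'(0)=v$, one has $\alpha''(0)=-h(v,v)\,\nu(p)$ (so that $h$ is positive definite on the boundary of a round ball). The mean curvature is the trace $H(p)=\sum_{i=1}^{n-1}h(v_i,v_i)$ over an orthonormal basis $v_1,\dots,v_{n-1}$ of $T_p\partial X$. Mean convex means $H\ge 0$ on $\partial X$. *)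

(* Defs.v *)
From mathcomp Require Import all_boot all_order all_algebra.
From mathcomp Require Import all_classical all_reals all_analysis.

Set Implicit Arguments.
Unset Strict Implicit.
Unset Printing Implicit Defensive.

Import Order.TTheory GRing.Theory Num.Theory.
Import numFieldNormedType.Exports.

Local Open Scope classical_set_scope.
Local Open Scope ring_scope.

(* R^n is 'rV[R]_n: the library equips it with the sup norm, which has the same
   open, connected and bounded sets and the same derivatives as the Euclidean
   norm. All metric quantities below are computed with the inner product dot. *)
Definition dot (R : realType) (n : nat) (u v : 'rV[R]_n) : R :=
  \sum_(i < n) u ord0 i * v ord0 i.

Definition boundary (T : topologicalType) (X : set T) : set T :=
  closure X `\` X°.

Section C2.
Context (R : realType) (V : normedModType R).
Implicit Types (U X : set V) (f : V -> R).

(* The quantification is over all directions v and not only over a basis. *)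
Definition C1_on U f : Prop :=
  forall x, U x -> forall v : V,
    derivable f x v /\ {for x, continuous (fun y => 'D_v f y)}.

Definition C2_on U f : Prop :=
  C1_on U f /\ forall v : V, C1_on U (fun y => 'D_v f y).

(* On U, the boundary of X is the regular level set f = 0 and X is the side
   f < 0 of it. *)
Definition C2_defining_function X U f : Prop :=
  [/\ C2_on U f,
      forall x, U x -> boundary X x <-> f x = 0,
      forall x, U x -> X x <-> f x < 0 &
      forall x, U x -> f x = 0 -> exists v : V, 'D_v f x != 0].

Definition C2_domain X : Prop :=
  open X /\
  forall p, boundary X p ->
    exists U f, open_nbhs p U /\ C2_defining_function X U f.

End C2.

Section mean_curvature.
Context (R : realType) (n : nat).
Local Notation V := 'rV[R]_n.
Implicit Types (S X : set V) (nu : V -> V) (p v w : V).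

Definition curve_through S p v (gamma : R -> V) : Prop :=
  [/\ \forall t \near (0 : R), S (gamma t),
      gamma 0 = p &
      is_derive (0 : R) (1 : R) gamma v].

Definition tangent_space S p : set V :=
  [set v | exists gamma, curve_through S p v gamma].

(* Only the values of nu on the boundary of X matter. *)
Definition outward_unit_normal X nu : Prop :=
  forall p, boundary X p ->
    [/\ dot (nu p) (nu p) = 1,
        forall v, tangent_space (boundary X) p v -> dot (nu p) v = 0 &
        \forall t \near (0 : R)^'+, X (p - t *: nu p) /\ ~ X (p + t *: nu p)].

(* D_v nu for v tangent to S at p and nu given along S. On the C^2 hypersurfaces
   and normals considered here the derivative exists and is the same for all
   curves gamma. *)
Definition derivative_along S nu p v : V :=
  xget 0 [set d | exists gamma,
    curve_through S p v gamma /\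
    is_derive (0 : R) (1 : R) (nu \o gamma) d].

(* h(v, w) = <D_v nu, w>. With this sign, differentiating <alpha', nu o alpha>
   = 0 along a curve alpha in S with alpha(0) = p and alpha'(0) = v gives
   <alpha''(0), nu p> = - h(v, v); so alpha''(0) = - h(v, v) nu(p) when alpha is
   a geodesic, and h is positive definite on the boundary of a round ball with
   nu outward. *)
Definition second_fundamental_form S nu p v w : R :=
  dot (derivative_along S nu p v) w.

Definition orthonormal_tangent_basis S p (e : 'I_n.-1 -> V) : Prop :=
  [/\ forall i, tangent_space S p (e i),
      forall i j, dot (e i) (e j) = (i == j)%:R &
      forall v, tangent_space S p v ->
        exists c : 'I_n.-1 -> R, v = \sum_i c i *: e i].

(* The trace of h over an orthonormal basis of the tangent space; the basis is
   chosen, but the trace does not depend on it. *)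
Definition mean_curvature S nu p : R :=
  let e := xget (fun=> 0) (orthonormal_tangent_basis S p) in
  \sum_(i < n.-1) second_fundamental_form S nu p (e i) (e i).

End mean_curvature.

Definition is_component (T : topologicalType) (A Sigma : set T) : Prop :=
  exists2 p, A p & Sigma = connected_component A p.

(* Main.v *)
Require Import Defs.
From HB Require Import structures.
From mathcomp Require Import all_boot all_order all_algebra.
From mathcomp Require Import all_classical all_reals all_analysis.
From mathcomp Require Import ring lra.
Import Order.TTheory GRing.Theory Num.Theory.
Import numFieldNormedType.Exports.
Local Open Scope classical_set_scope.
Local Open Scope ring_scope.

Set Implicit Arguments.
Unset Strict Implicit.
Unset Printing Implicit Defensive.

(** Suppose H >= c > 0 on a component S of the boundary, and let S' be the rest of
    the boundary. Both are closed (boundary_component_complement_closed), and as X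
    is connected it contains points at equal distance from S and S'. If the
    smallest such distance were attained, the nearest points p in S and q in S'
    would be joined by a straight link in X whose length cannot be decreased.
    Translating it along parallel directions v changes its length at second order
    by -(h_p(v, v) + h_q(v, v)) / 2, so that all these sums would be <= 0; summing
    over an orthonormal frame gives H(p) + H(q) <= 0, which contradicts
    H(p) >= c and H(q) >= 0.

    In an unbounded domain a closest pair need not exist. Instead
    sqrt d + eps |z|^2 is minimised over the closed set of equidistant points z,
    where d is the distance from z to S and to S'. The minimiser z has nearest
    points p and q, and the broken segment p z q is minimal for a functional
    d^2 + tau |z|^2 with small tau, among all nearby positions of z and of the
    ends on the boundary (equidistant_min_link): a competitor whose halves are
    unequal is slid along its longer half to an equidistant point, which lowers
    the functional.

    The first variation shows that the two halves are nearly in line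
    (link_nearly_straight). For the second variation the end p moves with velocity
    v and the end q with the image of v under the rotation that takes one half of
    the link to the other (link_second_variation); that the boundary follows these
    motions up to a quadratic term governed by its second fundamental form is
    boundary_second_order. The sum over a frame (link_curvature_bound) is
    c d^3 <= 4 tau^2 |z|^2 + 4 (n - 1) tau d^2, and the choice of functional makes
    the right-hand side o(d^3) as eps tends to 0
    (mean_curvature_not_bounded_below). *)

(** * Inner product and Euclidean norm *)

Section EuclideanNorm.
Context (R : realType) (n : nat).
Local Notation V := 'rV[R]_n.
Implicit Types (u v w : V) (a : R).

Lemma dotC u v : dot u v = dot v u.
Proof. by apply: eq_bigr => i _; rewrite mulrC. Qed.

Lemma dotDl u v w : dot (u + v) w = dot u w + dot v w.
Proof. by rewrite -big_split; apply: eq_bigr => i _; rewrite !mxE mulrDl. Qed.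

Lemma dotDr u v w : dot w (u + v) = dot w u + dot w v.
Proof. by rewrite dotC dotDl !(dotC w). Qed.

Lemma dotZl a u v : dot (a *: u) v = a * dot u v.
Proof. by rewrite mulr_sumr; apply: eq_bigr => i _; rewrite !mxE mulrA. Qed.

Lemma dotZr a u v : dot u (a *: v) = a * dot u v.
Proof. by rewrite dotC dotZl dotC. Qed.

Lemma dotNl u v : dot (- u) v = - dot u v.
Proof. by rewrite -scaleN1r dotZl mulN1r. Qed.

Lemma dotNr u v : dot u (- v) = - dot u v.
Proof. by rewrite dotC dotNl dotC. Qed.

Lemma dot0l u : dot 0 u = 0.
Proof. by rewrite -(scale0r u) dotZl mul0r. Qed.

Lemma dot0r u : dot u 0 = 0.
Proof. by rewrite dotC dot0l. Qed.

Lemma dot_suml m (F : 'I_m -> V) v : dot (\sum_i F i) v = \sum_i dot (F i) v.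
Proof.
elim/big_rec2: _ => [|i x y _ <-]; first exact: dot0l.
exact: dotDl.
Qed.

Definition dot_lin := (dotDl, dotDr, dotNl, dotNr, dotZl, dotZr, dot0l, dot0r).

Lemma dot_ge0 u : 0 <= dot u u.
Proof. by apply: sumr_ge0 => i _; rewrite -expr2 sqr_ge0. Qed.

Lemma coord_sqr_le_dot u i : u ord0 i ^+ 2 <= dot u u.
Proof.
rewrite /dot (bigD1 i) //= expr2 lerDl.
by apply: sumr_ge0 => j _; rewrite -expr2 sqr_ge0.
Qed.

Lemma dot_eq0 u : (dot u u == 0) = (u == 0).
Proof.
apply/eqP/eqP => [u0|->]; last exact: dot0l.
apply/rowP => i; rewrite mxE; apply/eqP.
by rewrite -sqrf_eq0 eq_le sqr_ge0 -u0 coord_sqr_le_dot.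
Qed.

Lemma dot_gt0 u : (0 < dot u u) = (u != 0).
Proof. by rewrite lt_neqAle dot_ge0 andbT eq_sym dot_eq0. Qed.

Lemma cauchy_schwarz u v : dot u v ^+ 2 <= dot u u * dot v v.
Proof.
have [->|v0] := eqVneq v 0; first by rewrite !dot_lin expr0n /= mulr0.
have vv : 0 < dot v v by rewrite dot_gt0.
have := dot_ge0 (dot v v *: u - dot u v *: v).
rewrite !dot_lin (dotC v u) => h.
rewrite -(ler_pM2l vv); nra.
Qed.

Definition enorm u : R := Num.sqrt (dot u u).

Lemma enorm_ge0 u : 0 <= enorm u. Proof. exact: sqrtr_ge0. Qed.

Lemma enorm_sqr u : enorm u ^+ 2 = dot u u.
Proof. by rewrite sqr_sqrtr // dot_ge0. Qed.

Lemma enorm_eq0 u : (enorm u == 0) = (u == 0).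
Proof. by rewrite -sqrf_eq0 enorm_sqr dot_eq0. Qed.

Lemma enorm_gt0 u : (0 < enorm u) = (u != 0).
Proof. by rewrite lt_neqAle enorm_ge0 andbT eq_sym enorm_eq0. Qed.

Lemma enorm0 : enorm 0 = 0. Proof. by rewrite /enorm dot0l sqrtr0. Qed.

Lemma enormN u : enorm (- u) = enorm u.
Proof. by rewrite /enorm !dot_lin opprK. Qed.

Lemma enormB u v : enorm (u - v) = enorm (v - u).
Proof. by rewrite -enormN opprB. Qed.

Lemma enormZ a u : enorm (a *: u) = `|a| * enorm u.
Proof. by rewrite /enorm !dot_lin mulrA -expr2 sqrtrM ?sqr_ge0 // sqrtr_sqr. Qed.

Lemma dot_norm_le u v : `|dot u v| <= enorm u * enorm v.
Proof.
rewrite -(@ler_pXn2r _ 2%N) ?nnegrE ?mulr_ge0 ?enorm_ge0 //.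
by rewrite real_normK ?num_real // exprMn !enorm_sqr cauchy_schwarz.
Qed.

Lemma dot_le u v : dot u v <= enorm u * enorm v.
Proof. exact: le_trans (ler_norm _) (dot_norm_le _ _). Qed.

Lemma enorm_triangle u v : enorm (u + v) <= enorm u + enorm v.
Proof.
rewrite -(@ler_pXn2r _ 2%N) ?nnegrE ?addr_ge0 ?enorm_ge0 //.
have := dot_le u v; rewrite enorm_sqr !dot_lin (dotC v u) sqrrD !enorm_sqr.
by move=> h; lra.
Qed.

Lemma norm_le_enorm u : `|u| <= enorm u.
Proof.
rewrite [leLHS]/Num.Def.normr /= mx_normrE.
apply: (bigmax_le _ (enorm_ge0 _)) => -[i j] _ /=.
rewrite (ord1 i) -(@ler_pXn2r _ 2%N) ?nnegrE ?normr_ge0 ?enorm_ge0 //.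
by rewrite real_normK ?num_real // enorm_sqr coord_sqr_le_dot.
Qed.

Lemma continuous_coord i : continuous (fun u : V => u ord0 i).
Proof. by move=> u; exact: coord_continuous. Qed.

Lemma continuous_dot (T : topologicalType) (f g : T -> V) (x : T) :
  {for x, continuous f} -> {for x, continuous g} ->
  {for x, continuous (fun y => dot (f y) (g y))}.
Proof.
move=> cf cg; apply: cvg_big => [|i _]; first exact: add_continuous.
apply: cvgM.
  exact: (continuous_comp cf (@continuous_coord i (f x))).
exact: (continuous_comp cg (@continuous_coord i (g x))).
Qed.

Lemma continuous_enorm (T : topologicalType) (f : T -> V) (x : T) :
  {for x, continuous f} -> {for x, continuous (fun y => enorm (f y))}.
Proof.
move=> cf.
exact: (continuous_comp (continuous_dot cf cf) (@sqrt_continuous R _)).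
Qed.

Lemma continuous_enormB z : continuous (fun p : V => enorm (z - p)).
Proof.
move=> p; apply: (@continuous_enorm V (fun p => z - p) p).
by apply: (@cvgB _ _ _ (nbhs p)); [exact: cvg_cst|exact: cvg_id].
Qed.

End EuclideanNorm.

(** * Euclidean distance to a closed set *)

Section DistanceToClosedSet.
Context (R : realType) (n : nat).
Local Notation V := 'rV[R]_n.
Implicit Types (S : set V) (z w p : V).

(** Existence of a minimum by the direct method: bounded closed sets are
    compact. *)
Lemma closed_min (A : set V) (g : V -> R) w0 : closed A -> A w0 ->
    continuous g -> bounded_set [set z | A z /\ g z <= g w0] ->
  exists2 z, A z & forall w, A w -> g z <= g w.
Proof.
move=> cA Aw0 cg bA.
have cB : closed [set z | A z /\ g z <= g w0].
  apply: closedI => //; rewrite -[X in closed X]/(g @^-1` [set t | t <= g w0]).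
  by apply: closed_comp => [z _|]; [exact: cg|exact: closed_le].
have [|z] := EVT_min_rV _ (bounded_closed_compact bA cB) (@continuous_subspaceT _ _ _ _ cg).
  by exists w0.
rewrite inE => -[Az gz] zmin; exists z => // w Aw.
have [gw|/ltW gw] := leP (g w) (g w0); first by apply: zmin; rewrite inE.
exact: le_trans gz gw.
Qed.

Lemma enorm_ball_bounded p (r : R) (A : set V) :
  (forall z, A z -> enorm (z - p) <= r) -> bounded_set A.
Proof.
move=> Ar; exists (r + enorm p); split; first exact: num_real.
move=> M rM z Az /=; apply: le_trans (norm_le_enorm z) _.
rewrite -[X in enorm X](subrK p) (le_trans (enorm_triangle _ _)) //.
by rewrite (le_trans _ (ltW rM)) // lerD2r Ar.
Qed.

Definition edist S z : R := inf [set enorm (z - p) | p in S].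

Lemma edist_attained S z : closed S -> S !=set0 ->
  exists2 p, S p & edist S z = enorm (z - p).
Proof.
move=> cS [p0 Sp0].
have cg := @continuous_enormB _ _ z.
have [|p Sp pmin] := @closed_min S (fun p => enorm (z - p)) p0 cS Sp0 cg.
  apply: (@enorm_ball_bounded z (enorm (z - p0))) => w [_].
  by rewrite enormB.
exists p => //; apply/eqP; rewrite eq_le; apply/andP; split.
  apply: ge_inf; last by exists p.
  by exists 0 => _ [w _ <-]; exact: enorm_ge0.
apply: lb_le_inf; first by exists (enorm (z - p)), p.
by move=> _ [w Sw <-]; exact: pmin.
Qed.

Lemma edist_le S z p : S p -> edist S z <= enorm (z - p).
Proof.
move=> Sp; apply: ge_inf; last by exists p.
by exists 0 => _ [w _ <-]; exact: enorm_ge0.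
Qed.

Lemma edist_ge0 S z : 0 <= edist S z.
Proof.
have [->|/set0P[p Sp]] := eqVneq S set0.
  by rewrite /edist image_set0 inf0.
apply: lb_le_inf; first by exists (enorm (z - p)), p.
by move=> _ [w Sw <-]; exact: enorm_ge0.
Qed.

Lemma edist_mem S z : S z -> edist S z = 0.
Proof.
move=> Sz; apply/eqP; rewrite eq_le edist_ge0 andbT.
by rewrite (le_trans (edist_le _ Sz)) // subrr enorm0.
Qed.

Lemma edist_gt0 S z : closed S -> S !=set0 -> ~ S z -> 0 < edist S z.
Proof.
move=> cS S0 Sz; have [p Sp ->] := edist_attained z cS S0.
by rewrite enorm_gt0 subr_eq0; apply: contra_notN Sz => /eqP ->.
Qed.

Lemma edist_lip S z w : closed S -> S !=set0 ->
  edist S z <= edist S w + enorm (z - w).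
Proof.
move=> cS S0; have [p Sp ->] := edist_attained w cS S0.
apply: le_trans (edist_le z Sp) _.
by rewrite [leRHS]addrC -[z - p](subrKA w) enorm_triangle.
Qed.

Lemma continuous_edist S : closed S -> S !=set0 -> continuous (edist S).
Proof.
move=> cS S0 z; apply/(@cvgrPdist_le _ R^o _ (nbhs z)) => e e0.
have zw := @continuous_enormB _ _ z z.
move/(@cvgrPdist_le _ R^o _ (nbhs z)) : zw => /(_ e e0).
apply: filterS => w; rewrite subrr enorm0 sub0r normrN ger0_norm ?enorm_ge0 //.
move=> we; have := edist_lip z w cS S0; have := edist_lip w z cS S0.
rewrite (enormB w z) ler_distl => h1 h2; apply/andP; split; lra.
Qed.

End DistanceToClosedSet.

(** * Directional derivatives and the gradient *)

Section LineDerivatives.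
Context (R : realType).

Lemma MVT_origin (f df : R -> R) (t : R) :
    (forall s : R, `|s| <= `|t| -> is_derive s (1 : R) f (df s)) ->
  exists2 c, `|c| <= `|t| & f t - f 0 = df c * t.
Proof.
move=> fdf; have cf (a b : R) : (forall s, s \in `[a, b] -> `|s| <= `|t|) ->
    {within `[a, b], continuous f}.
  move=> ab; apply: derivable_within_continuous => s /ab /fdf fs.
  exact: ex_derive.
have [t0|t0] := leP 0 t.
  have le0 s : s \in `[0, t] -> `|s| <= `|t|.
    by rewrite in_itv /= => /andP[s0 st]; rewrite !ger0_norm.
  have [s /subset_itv_oo_cc /le0 /fdf //|c /le0 ct] :=
    @MVT_segment _ f df 0 t t0 _ (cf _ _ le0).
  by rewrite subr0 => ->; exists c.
have le0 s : s \in `[t, 0] -> `|s| <= `|t|.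
  by rewrite in_itv /= => /andP[ts s0]; rewrite !ler0_norm ?lerN2 // ltW.
have [s /subset_itv_oo_cc /le0 /fdf //|c /le0 ct e] :=
  @MVT_segment _ f df t 0 (ltW t0) _ (cf _ _ le0).
by exists c => //; apply/eqP; rewrite -eqr_opp opprB e sub0r mulrN.
Qed.

Lemma is_derive_line (V W : normedModType R) (f : V -> W) p v (s : R) :
  derivable f (p + s *: v) v ->
  is_derive s (1 : R) (fun t => f (p + t *: v)) ('D_v f (p + s *: v)).
Proof.
move=> fv.
suff e : (fun h => h^-1 *: (((fun t => f (p + t *: v)) \o shift s) (h *: 1)
      - f (p + s *: v))) =
    (fun h => h^-1 *: ((f \o shift (p + s *: v)) (h *: v) - f (p + s *: v))).
  split; first by rewrite /derivable e.
  by rewrite /derive e.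
apply/funext => h /=; congr (_ *: (f _ - _)).
by rewrite scalerDl /GRing.scale /= mulr1 addrCA.
Qed.

Lemma is_derive_scalel (V : normedModType R) (k : R -> R) (t : R) dk (w : V) :
  is_derive t (1 : R) k dk -> is_derive t (1 : R) (fun t => k t *: w) (dk *: w).
Proof.
move=> kt; have /derivable1_diffP kd := @ex_derive _ _ _ _ _ _ _ kt.
have kwd := differentiableZl w kd.
split; first exact/derivable1_diffP.
by rewrite deriveE // diffZl //= -deriveE // derive_val.
Qed.

Lemma is_derive_affine (V : normedModType R) (p v : V) (t : R) :
  is_derive t (1 : R) (fun t => p + t *: v) v.
Proof.
have := is_deriveD (is_derive_cst p t (1 : R))
  (is_derive_scalel v (is_derive_id t (1 : R))).
by rewrite add0r scale1r.
Qed.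

Lemma is_derive_continuous (V : normedModType R) (x : R -> V) (t : R) v :
  is_derive t (1 : R) x v -> {for t, continuous x}.
Proof.
by case=> xd _; exact/differentiable_continuous/derivable1_diffP.
Qed.

Lemma continuous_affine (V : normedModType R) (p v : V) :
  continuous (fun t : R => p + t *: v).
Proof. by move=> t; exact: is_derive_continuous (is_derive_affine p v t). Qed.

Lemma is_derive_curve (V W : normedModType R) (f : V -> W) (x : R -> V) (t : R) v :
  differentiable f (x t) -> is_derive t (1 : R) x v ->
  is_derive t (1 : R) (f \o x) ('D_v f (x t)).
Proof.
move=> fd xt; have /derivable1_diffP xd := @ex_derive _ _ _ _ _ _ _ xt.
have fxd := differentiable_comp xd fd.
split; first exact/derivable1_diffP.
by rewrite deriveE // diff_comp //= -[X in 'd f _ X]deriveE // derive_val deriveE.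
Qed.

Lemma is_derive_expand (V : normedModType R) (x : R -> V) (t : R) v :
    is_derive t (1 : R) x v -> forall eps : R, 0 < eps ->
  \forall h \near (0 : R), `|x (h + t) - x t - h *: v| <= eps * `|h|.
Proof.
move=> xt eps eps0; have xd : differentiable x t.
  by apply/derivable1_diffP; exact: ex_derive.
have := diff_locally xd; rewrite diff1E // derive1E derive_val.
move=> /eqaddoP /(_ eps eps0); apply: filterS => h.
by rewrite /= !fctE /= opprD addrA.
Qed.

Lemma is_derive_quadratic (k : R -> R) (C : R) : k 0 = 0 ->
  (\forall t \near (0 : R), `|k t| <= C * t ^+ 2) ->
  is_derive (0 : R) (1 : R) k 0.
Proof.
move=> k0 kC.
suff c : h^-1 *: ((k \o shift 0) (h *: (1 : R)) - k 0) @[h --> 0^'] --> (0 : R).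
  split; last exact/cvg_lim.
  by apply/cvg_ex; exists 0.
apply/cvgrPdist_le => eps eps0.
have C0 : 0 < `|C| + 1 by rewrite ltr_wpDl.
near=> h.
have h0 : h != 0 by near: h; exact: nbhs_dnbhs_neq.
have hC : `|k h| <= C * h ^+ 2 by near: h; exact: nbhs_dnbhs.
have he : `|h| < eps / (`|C| + 1) by near: h; apply: dnbhs0_lt; rewrite divr_gt0.
rewrite /= k0 subr0 addr0 sub0r normrN /GRing.scale /= mulr1 normrM normfV.
rewrite ler_pdivrMl ?normr_gt0 // (le_trans hC) //.
rewrite -(real_normK (num_real h)) expr2 mulrCA ler_wpM2l //.
move: he; rewrite ltr_pdivlMr // => /ltW he; apply: le_trans he.
by rewrite mulrC ler_wpM2l // ler_wpDr // ler_norm.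
Unshelve. all: by end_near. Qed.

End LineDerivatives.

(** The inner product with a fixed second factor, named so that it can carry the
    linear structure that differentials need. *)
Definition dotr (R : realType) (n : nat) (g : 'rV[R]_n) (v : 'rV[R]_n) : R :=
  dot v g.

Lemma dotr_is_linear (R : realType) (n : nat) (g : 'rV[R]_n) :
  linear (dotr g : 'rV[R]_n -> R^o).
Proof. by move=> a u v; rewrite /dotr !dot_lin. Qed.

HB.instance Definition _ (R : realType) (n : nat) (g : 'rV[R]_n) :=
  GRing.isLinear.Build R 'rV[R]_n R^o *:%R (dotr g) (dotr_is_linear g).

Section Gradient.
Context (R : realType) (n : nat).
Local Notation V := 'rV[R]_n.
Implicit Types (U : set V) (f : V -> R) (x v : V).

Definition basis_vec (i : 'I_n) : V := delta_mx ord0 i.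

Definition grad f x : V := \row_i 'D_(basis_vec i) f x.

Lemma basis_sum v : v = \sum_i v ord0 i *: basis_vec i.
Proof. exact: row_sum_delta. Qed.

Lemma dot_basis v i : dot v (basis_vec i) = v ord0 i.
Proof.
rewrite /dot (bigD1 i) //= big1 => [|j ji]; first by rewrite addr0 mxE !eqxx mulr1.
by rewrite mxE (negbTE ji) andbF mulr0.
Qed.

Lemma continuous_dotr (g : V) : continuous (dotr g).
Proof.
move=> x; apply: (@continuous_dot _ _ V id (cst g) x).
  exact (@cvg_id _ (nbhs x)).
exact (@cvg_cst _ g _ (nbhs x) _).
Qed.

Lemma norm_coord_le v i : `|v ord0 i| <= `|v|.
Proof.
rewrite [leRHS]/Num.Def.normr /= mx_normrE.
exact: (le_bigmax _ (fun ij => `|v ij.1 ij.2|) (ord0, i)).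
Qed.

Lemma norm_le_coord v (r : R) :
  0 <= r -> (forall i, `|v ord0 i| <= r) -> `|v| <= r.
Proof.
move=> r0 vr; rewrite [leLHS]/Num.Def.normr /= mx_normrE.
by apply: (bigmax_le _ r0) => -[i j] _ /=; rewrite (ord1 i).
Qed.

(** Moving from x to x + v one coordinate at a time, each step is governed by
    the mean value theorem for one partial derivative, which is close to its
    value at x. *)
Lemma C1_is_diff U f x :
  open U -> U x -> C1_on U f -> is_diff x f (dotr (grad f x)).
Proof.
move=> oU Ux f1.
suff e : (f : V -> R^o) \o shift x =
    cst (f x : R^o) + (dotr (grad f x) : V -> R^o) +o_ (0 : V) id.
  have de := diff_unique (@continuous_dotr (grad f x)) e.
  apply: DiffDef => //; apply/diff_locallyP; rewrite de; split => //.
  exact: continuous_dotr.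
apply/eqaddoP => eps eps0.
(* each of the n coordinates may contribute at most eps / n; the successor
   keeps the quotient meaningful in dimension 0 *)
have e0 : 0 < eps / n.+1%:R by rewrite divr_gt0.
have : \forall y \near x, U y /\ forall i,
    `|'D_(basis_vec i) f x - 'D_(basis_vec i) f y| <= eps / n.+1%:R.
  apply: filterI; first exact: open_nbhs_nbhs.
  apply: (@filter_forall _ _ _ (nbhs x) _) => i.
  have [_ ci] := f1 x Ux (basis_vec i).
  exact: (@cvgrPdist_le _ R^o _ (nbhs x) _ _ _).1 ci _ e0.
move=> /nbhs_ballP[r /= r0 xr].
apply/nbhs_ballP; exists r => //= v; rewrite -ball_normE /= sub0r normrN => vr.
pose w k : V := \row_i (if (i < k)%N then v ord0 i else 0).
have wk k (kn : (k < n)%N) :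
    w k.+1 = w k + v ord0 (Ordinal kn) *: basis_vec (Ordinal kn).
  apply/rowP => i; rewrite !mxE eqxx /= ltnS leq_eqVlt.
  have [ik|ik] := eqVneq (i : nat) k.
    have -> : i = Ordinal kn by exact: val_inj.
    by rewrite /= ltnn eqxx add0r mulr1.
  have -> : (i == Ordinal kn) = false by apply/negbTE; apply: contra ik => /eqP ->.
  by rewrite mulr0 addr0.
have near k (kn : (k < n)%N) s : `|s| <= `|v ord0 (Ordinal kn)| ->
    ball x r (x + w k + s *: basis_vec (Ordinal kn)).
  move=> sv; rewrite -ball_normE /= -addrA opprD addrA subrr sub0r normrN.
  apply: le_lt_trans vr; apply: norm_le_coord => // i.
  rewrite !mxE eqxx /=; have [->|ik] := eqVneq i (Ordinal kn).
    by rewrite /= ltnn add0r mulr1 (le_trans sv) // norm_coord_le.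
  rewrite mulr0 addr0; case: ifP => _; first exact: norm_coord_le.
  by rewrite normr0.
have step k (kn : (k < n)%N) :
    `|f (x + w k.+1) - f (x + w k)
      - v ord0 (Ordinal kn) * grad f x ord0 (Ordinal kn)| <= eps / n.+1%:R * `|v|.
  set i := Ordinal kn; set t := v ord0 i.
  have [|c ct] := @MVT_origin _ (fun s => f (x + w k + s *: basis_vec i))
      (fun s => 'D_(basis_vec i) f (x + w k + s *: basis_vec i)) t.
    move=> s st; apply: is_derive_line.
    have [Uy _] := xr _ (near k kn s st).
    by have [] := f1 _ Uy (basis_vec i).
  rewrite scale0r addr0 -addrA -wk => ->.
  have [_ /(_ i)] := xr _ (near k kn c ct).
  rewrite mxE [_ * t]mulrC -mulrBr normrM => h.
  rewrite mulrC ler_pM //; last exact: norm_coord_le.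
  by rewrite distrC.
have tele k : (k <= n)%N -> `|f (x + w k) - f x
      - \sum_(i < n | (i < k)%N) v ord0 i * grad f x ord0 i|
    <= k%:R * (eps / n.+1%:R * `|v|).
  elim: k => [_|k IH kn].
    have -> : w 0%N = 0 by apply/rowP => i; rewrite !mxE.
    by rewrite addr0 subrr big_pred0 // subr0 normr0 mul0r.
  have := IH (ltnW kn); have := step k kn.
  have Ek (i : 'I_n) : ((i < k.+1)%N && (i != Ordinal kn)) = (i < k)%N.
    by rewrite -val_eqE /= ltnS; case: ltngtP.
  have kk : (Ordinal kn < k.+1)%N by exact: ltnSn.
  rewrite (bigD1 _ kk) (eq_bigl _ _ Ek) /=.
  rewrite -[k.+1]addn1 natrD mulrDl mul1r.
  set S := \sum_(i < n | _) _; set a := f _; set b := f (x + w k); set c := _ * _.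
  move=> h1 h2; rewrite [leLHS](_ : _ = `|(b - f x - S) + (a - b - c)|).
    by rewrite (le_trans (ler_normD _ _)) // lerD.
  by congr (`|_|); ring.
have := tele n (leqnn n).
have -> : w n = v by apply/rowP => i; rewrite mxE ltn_ord.
under eq_bigl do rewrite ltn_ord.
move=> h; rewrite [leLHS](_ : _ =
    `|f (x + v) - f x - \sum_(i < n) v ord0 i * grad f x ord0 i|); last first.
  by rewrite [x + v]addrC -addrA -opprD.
apply: le_trans h _; rewrite mulrA; apply: ler_wpM2r => //.
have n1 : n%:R / n.+1%:R <= 1 :> R by rewrite ler_pdivrMr // mul1r ler_nat.
by rewrite mulrCA -[leRHS]mulr1 ler_wpM2l // ltW.
Qed.

End Gradient.

Section C1Facts.
Context (R : realType) (n : nat).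
Local Notation V := 'rV[R]_n.
Implicit Types (U : set V) (f : V -> R) (x v : V).

Lemma C1_differentiable U f x :
  open U -> U x -> C1_on U f -> differentiable f x.
Proof. by move=> oU Ux /(C1_is_diff oU Ux) fx; exact: ex_diff. Qed.

Lemma C1_derive U f x v :
  open U -> U x -> C1_on U f -> 'D_v f x = dot v (grad f x).
Proof.
move=> oU Ux /(C1_is_diff oU Ux) fx; rewrite deriveE; last exact: ex_diff.
by rewrite diff_val.
Qed.

Lemma differentiable_rows (g : 'I_n -> V -> R) x :
  (forall i, differentiable (g i) x) ->
  differentiable (fun y => \row_i g i y : V) x.
Proof.
move=> gx; have -> : (fun y => \row_i g i y : V) =
    \sum_i (fun y => g i y *: basis_vec R i).
  apply/funext => y; rewrite fct_sumE [LHS]basis_sum.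
  by apply: eq_bigr => i _; rewrite mxE.
by apply: differentiable_sum => i; exact: differentiableZl.
Qed.

Lemma is_derive_sqr (t a : R) :
  is_derive t (1 : R) (fun t => t ^+ 2 * a) (2 * t * a).
Proof.
have h : is_derive t (1 : R) (fun t => t ^+ 2) (2 * t).
  split; first exact: exprn_derivable.
  by rewrite exp_derive expr1 scaler_nat /GRing.scale /= mulr1 mulr_natl.
exact: (@is_derive_scalel R R^o (fun t => t ^+ 2) t (2 * t) a h).
Qed.

(** Second-order Taylor expansion along the parabola p + t v + t^2 s e at a
    point where the derivative in the direction v vanishes. The derivative of f
    along the parabola is L t + o(t), and integrating by the mean value theorem
    gives the claim. *)
Lemma taylor_parabola U f p v e s (L := 'D_v ('D_v f) p / 2 + s * 'D_e f p) :
    open U -> U p -> C2_on U f -> 'D_v f p = 0 ->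
  forall eps : R, 0 < eps -> \forall t \near (0 : R),
    `|f (p + t *: v + (t ^+ 2 * s) *: e) - f p - t ^+ 2 * L| <= eps * t ^+ 2.
Proof.
move=> oU Up [f1 f2] fv0 eps eps0.
pose x t : V := p + t *: v + (t ^+ 2 * s) *: e.
have x0 : x 0 = p by rewrite /x scale0r expr0n /= mul0r scale0r !addr0.
have xt (t : R) : is_derive t (1 : R) x (v + (2 * t * s) *: e).
  have h2 : is_derive t (1 : R) (fun t => t ^+ 2 * s) (2 * t * s).
    exact: is_derive_sqr.
  have h3 := is_derive_scalel e h2.
  exact: (is_deriveD (is_derive_affine p v t) h3).
have xc : {for 0, continuous x} := is_derive_continuous (xt 0).
have nU : \forall t \near (0 : R), U (x t).
  by apply: xc; rewrite x0; exact: open_nbhs_nbhs.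
pose h t := f (x t) - t ^+ 2 * L.
pose dh t := 'D_v f (x t) + 2 * t * s * 'D_e f (x t) - 2 * t * L.
have hd (t : R) : U (x t) -> is_derive t (1 : R) h (dh t).
  move=> Ut; have fd := C1_differentiable oU Ut f1.
  have k1 := is_derive_curve fd (xt t).
  have k2 : is_derive t (1 : R) (fun t => t ^+ 2 * L) (2 * t * L).
    exact: is_derive_sqr.
  apply: (is_derive_eq (is_deriveB k1 k2)).
  by rewrite /dh !(C1_derive _ oU Ut f1) dotDl dotZl.
(* both parts of dh t are o(t): the first by differentiability of 'D_v f along
   the parabola, the second by continuity of 'D_e f *)
have ndh : \forall t \near (0 : R), `|dh t| <= eps * `|t|.
  have Gd : is_derive (0 : R) (1 : R) ('D_v f \o x) ('D_v ('D_v f) p).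
    have fd : differentiable ('D_v f) (x 0).
      by rewrite x0; exact: C1_differentiable oU Up (f2 v).
    by have := is_derive_curve fd (xt 0); rewrite mulr0 mul0r scale0r addr0 x0.
  have G1 : \forall t \near (0 : R),
      `|'D_v f (x t) - t * 'D_v ('D_v f) p| <= eps / 2 * `|t|.
    have := is_derive_expand Gd; move=> /(_ (eps / 2)).
    rewrite divr_gt0 // => /(_ isT); apply: filterS => t.
    by rewrite /= addr0 x0 fv0 subr0.
  have G2 : \forall t \near (0 : R),
      `|2 * s * ('D_e f (x t) - 'D_e f p)| <= eps / 2.
    have [_ ce] := f1 p Up e.
    have ce' : {for x 0, continuous ('D_e f)} by rewrite x0.
    have cx := continuous_comp xc ce'.
    have s0 : 0 < 2 * `|s| + 1 by rewrite ltr_wpDl ?mulr_ge0.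
    move/cvgrPdist_le : cx => /(_ (eps / 2 / (2 * `|s| + 1))).
    rewrite !divr_gt0 // => /(_ isT); apply: filterS => t /=.
    rewrite x0 ler_pdivlMr // distrC !normrM normr_nat => h1.
    rewrite (le_trans _ h1) // mulrC ler_wpM2l // ler_wpDr //.
  apply: filterS2 G1 G2 => t g1 g2.
  have -> : dh t = ('D_v f (x t) - t * 'D_v ('D_v f) p)
      + t * (2 * s * ('D_e f (x t) - 'D_e f p)) by rewrite /dh /L; field.
  apply: (le_trans (ler_normD _ _)).
  have -> : eps * `|t| = eps / 2 * `|t| + eps / 2 * `|t| by field.
  by apply: lerD => //; rewrite normrM mulrC ler_wpM2r.
have /nbhs_ballP[r /= r0 hr] : \forall t \near (0 : R),
    U (x t) /\ `|dh t| <= eps * `|t| by exact: filterI nU ndh.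
apply/nbhs_ballP; exists r => //= t.
rewrite -ball_normE /= sub0r normrN => tr.
have near_t c : `|c| <= `|t| -> U (x c) /\ `|dh c| <= eps * `|c|.
  move=> ct; apply: hr; rewrite -ball_normE /= sub0r normrN.
  exact: le_lt_trans ct tr.
have [c /near_t [Uc] ct|c ct] := @MVT_origin _ h dh t; first exact: hd.
rewrite {1 2}/h x0 expr0n /= mul0r subr0.
have -> : f (x t) - t ^+ 2 * L - f p = f (x t) - f p - t ^+ 2 * L by ring.
move=> ->; rewrite normrM -(real_normK (num_real t)) expr2 mulrA ler_wpM2r //.
have [_ h1] := near_t c ct; apply: le_trans h1 _.
by rewrite ler_wpM2l // ltW.
Qed.

End C1Facts.

(** * Orthonormal frames of a hyperplane *)

Section NormalFrames.
Context (R : realType) (n : nat).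
Local Notation V := 'rV[R]_n.
Implicit Types (u v nu : V) (e : 'I_n.-1 -> V).

Definition normal_frame nu e : Prop :=
  (forall i j, dot (e i) (e j) = (i == j)%:R) /\ forall i, dot (e i) nu = 0.

Lemma dot_basis_basis i j : dot (basis_vec R i) (basis_vec R j : V) = (i == j)%:R.
Proof. by rewrite dot_basis mxE eqxx /= eq_sym. Qed.

Definition reflect_along (w v : V) : V := v - (2 * dot v w / dot w w) *: w.

Lemma dot_reflect_along w u v :
  dot (reflect_along w u) (reflect_along w v) = dot u v.
Proof.
rewrite /reflect_along; have [->|w0] := eqVneq w 0.
  by rewrite !scaler0 !subr0.
have ww : dot w w != 0 by rewrite dot_eq0.
by rewrite !dot_lin (dotC w v); field.
Qed.

Lemma reflect_along_unit nu v : dot nu nu = 1 -> dot v v = 1 ->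
  reflect_along (nu - v) v = nu.
Proof.
move=> nn vv; rewrite /reflect_along; have [->|w0] := eqVneq nu v.
  by rewrite subrr scaler0 subr0.
have ww : dot (nu - v) (nu - v) != 0 by rewrite dot_eq0 subr_eq0.
have -> : 2 * dot v (nu - v) / dot (nu - v) (nu - v) = - 1.
  apply: (mulIf ww); rewrite divfK // !dot_lin nn vv (dotC nu v); ring.
by rewrite scaleN1r opprK addrC subrK.
Qed.

End NormalFrames.

Section FrameExpansions.
Context (R : realType).

(** The frame is the image of the standard basis vectors after the first one
    under the reflection that takes the first one to nu. *)
Lemma normal_frame_exists n (nu : 'rV[R]_n) :
  dot nu nu = 1 -> exists e, normal_frame nu e.
Proof.
case: n nu => [|m] nu nn; first by move: nn; rewrite /dot big_ord0 => /esym/eqP; rewrite oner_eq0.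
pose e0 : 'rV[R]_m.+1 := basis_vec R ord0.
have ee : dot e0 e0 = 1 by rewrite dot_basis_basis eqxx.
pose e (i : 'I_m) := reflect_along (nu - e0) (basis_vec R (lift ord0 i)).
exists e; split=> [i j|i].
  by rewrite dot_reflect_along dot_basis_basis (inj_eq lift_inj).
rewrite -[X in dot _ X](reflect_along_unit nn ee) dot_reflect_along.
by rewrite dot_basis_basis.
Qed.

Lemma normal_frame_mx n (nu : 'rV[R]_n.+1) (e : 'I_n -> 'rV[R]_n.+1) :
    dot nu nu = 1 -> normal_frame nu e ->
  exists E : 'M[R]_n.+1, [/\ E^T *m E = 1%:M, row ord0 E = nu &
    forall i, row (lift ord0 i) E = e i].
Proof.
move=> nn [ee en].
pose f k := if unlift ord0 k is Some i then e i else nu.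
have f0 : f ord0 = nu by rewrite /f unlift_none.
have fS i : f (lift ord0 i) = e i by rewrite /f liftK.
pose E : 'M[R]_n.+1 := \matrix_k f k.
have rE k : row k E = f k by rewrite rowK.
exists E; split; [|by rewrite rE|by move=> i; rewrite rE].
apply: mulmx1C; apply/matrixP => k l.
rewrite !mxE (eq_bigr (fun j => f k ord0 j * f l ord0 j)) => [|j _]; last first.
  by rewrite !mxE.
rewrite -/(dot (f k) (f l)).
case: (unliftP ord0 k) => [i|] ->; case: (unliftP ord0 l) => [j|] ->; rewrite ?fS ?f0.
- by rewrite ee (inj_eq lift_inj).
- by rewrite en.
- by rewrite dotC en.
- by rewrite nn eqxx.
Qed.

Lemma normal_frame_expand n (nu : 'rV[R]_n) e v :
    dot nu nu = 1 -> normal_frame nu e ->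
  v = dot v nu *: nu + \sum_i dot v (e i) *: e i.
Proof.
case: n nu e v => [|n] nu e v nn fe.
  by move: nn; rewrite /dot big_ord0 => /esym/eqP; rewrite oner_eq0.
have [E [E1 E0 ES]] := normal_frame_mx nn fe.
rewrite -[LHS]mulmx1 -E1 mulmxA mulmx_sum_row big_ord_recl E0.
have c k : (v *m E^T) ord0 k = dot v (row k E).
  by rewrite mxE; apply: eq_bigr => j _; rewrite !mxE.
by rewrite c E0; congr (_ + _); apply: eq_bigr => i _; rewrite c ES.
Qed.

Lemma normal_frame_parseval n (nu : 'rV[R]_n) e v :
    dot nu nu = 1 -> normal_frame nu e ->
  \sum_i dot v (e i) ^+ 2 = dot v v - dot v nu ^+ 2.
Proof.
move=> nn fe; have := normal_frame_expand v nn fe.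
move=> /(congr1 (fun w => dot w v)); rewrite dotDl dotZl dot_suml => ->.
rewrite (dotC nu v) expr2 addrAC subrr add0r.
by apply: eq_bigr => i _; rewrite dotZl (dotC v) expr2.
Qed.

(** The trace of Q is independent of the orthonormal basis, and nu completes the
    frame to such a basis. *)
Lemma normal_frame_trace n (nu : 'rV[R]_n) e (Q : 'M[R]_n) :
    dot nu nu = 1 -> normal_frame nu e ->
  \sum_i dot (e i *m Q) (e i) = \tr Q - dot (nu *m Q) nu.
Proof.
case: n nu e Q => [|n] nu e Q nn fe.
  by move: nn; rewrite /dot big_ord0 => /esym/eqP; rewrite oner_eq0.
have [E [E1 E0 ES]] := normal_frame_mx nn fe.
have -> : \tr Q = \sum_k dot (row k E *m Q) (row k E).
  rewrite -[Q in LHS]mul1mx -E1 -mulmxA mxtrace_mulC; apply: eq_bigr => k _.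
  rewrite mxE; apply: eq_bigr => j _.
  by rewrite -row_mul !mxE.
rewrite big_ord_recl E0 addrAC subrr add0r.
by apply: eq_bigr => i _; rewrite ES.
Qed.

End FrameExpansions.

Section Transport.
Context (R : realType) (n : nat).
Local Notation V := 'rV[R]_n.
Variables (a b : V).
Hypotheses (aa : dot a a = 1) (bb : dot b b = 1) (g0 : 1 + dot a b != 0).

(** The rotation of the plane of a and b that takes a to b, restricted to the
    hyperplane orthogonal to a. *)
Definition transport (v : V) : V := v - (dot b v / (1 + dot a b)) *: (a + b).

Lemma transport_orthogonal v : dot a v = 0 -> dot b (transport v) = 0.
Proof.
by move=> av; rewrite !dot_lin (dotC b a) bb; field.
Qed.

Lemma dot_transport u v : dot a u = 0 -> dot a v = 0 ->
  dot (transport u) (transport v) = dot u v.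
Proof.
move=> au av; rewrite !dot_lin (dotC u a) (dotC u b).
by rewrite au av aa bb (dotC b a); field.
Qed.

Lemma transport_frame e : normal_frame a e -> normal_frame b (transport \o e).
Proof.
move=> [ee ea]; have ae i : dot a (e i) = 0 by rewrite dotC.
split=> [i j|i] /=; first by rewrite dot_transport.
by rewrite dotC transport_orthogonal.
Qed.

End Transport.

(** * The boundary near one of its points *)

Section DefiningFunction.
Context (R : realType) (n : nat).
Local Notation V := 'rV[R]_n.
Variables (X U : set V) (f : V -> R).
Hypotheses (oU : open U) (fdef : C2_defining_function X U f).
Implicit Types (q v : V).

Let f2 : C2_on U f. Proof. by case: fdef. Qed.
Let f1 : C1_on U f. Proof. by case: f2. Qed.

Lemma boundary_zero q : U q -> boundary X q <-> f q = 0.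
Proof. by case: fdef => _ + _ _ => /[apply]. Qed.

Lemma interior_neg q : U q -> X q <-> f q < 0.
Proof. by case: fdef => _ _ + _ => /[apply]. Qed.

Lemma grad_neq0 q : U q -> f q = 0 -> grad f q != 0.
Proof.
case: fdef => _ _ _ reg Uq fq; have [v] := reg q Uq fq.
by rewrite (C1_derive _ oU Uq f1); apply: contra_neq => ->; rewrite dot0r.
Qed.

Definition unit_grad (g : V -> R) q : V := (enorm (grad g q))^-1 *: grad g q.

(** The value of s solves, by the intermediate value theorem, an equation whose
    second-order part is affine in s with slope - |grad f|. *)
Lemma zero_set_parabola q v (delta : R) :
    U q -> f q = 0 -> dot v (grad f q) = 0 -> 0 < delta ->
  \forall t \near (0 : R), exists s,
    `|s - 'D_v ('D_v f) q / (2 * enorm (grad f q))| <= delta /\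
    boundary X (q + t *: v - (t ^+ 2 * s) *: unit_grad f q).
Proof.
move=> Uq fq vG d0; set c := _ / _.
have G0 : 0 < enorm (grad f q) by rewrite enorm_gt0 grad_neq0.
(* at s = c +- delta the second-order coefficient of f is -+ delta |grad f|, and
   half of it absorbs the Taylor remainder *)
have e0 : 0 < delta * enorm (grad f q) / 2 by rewrite divr_gt0 ?mulr_gt0.
have fv : 'D_v f q = 0 by rewrite (C1_derive _ oU Uq f1).
set N := unit_grad f q.
have fN : 'D_(- N) f q = - enorm (grad f q).
  rewrite (C1_derive _ oU Uq f1) !dot_lin -enorm_sqr.
  by have h := lt0r_neq0 G0; field.
pose y (t s : R) : V := q + t *: v + (t ^+ 2 * s) *: (- N).
pose M := `|c| + delta.
have UM : \forall t \near (0 : R), forall s, `|s| <= M -> U (y t s).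
  have /nbhs_ballP[r /= r0 rU] : nbhs q U by exact: open_nbhs_nbhs.
  have K0 : 0 < `|v| + M * `|N| + 1.
    by rewrite ltr_wpDl // addr_ge0 // mulr_ge0 // addr_ge0 // ltW.
  apply/nbhs_ballP; exists (Num.min 1 (r / (`|v| + M * `|N| + 1))) => /=.
    by rewrite lt_min ltr01 divr_gt0.
  move=> t; rewrite -ball_normE /= sub0r normrN lt_min => /andP[t1].
  rewrite ltr_pdivlMr // => tr s sM; apply: rU; rewrite -ball_normE /=.
  rewrite /y -addrA opprD addrA subrr sub0r normrN; apply: le_lt_trans tr.
  apply: (le_trans (ler_normD _ _)); rewrite (normrZ t v) (normrZ (t ^+ 2 * s)) (normrN N) normrM normrX expr2.
  have := ler_wpM2r (normr_ge0 N) sM; have := normr_ge0 s; have := normr_ge0 t.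
  have := normr_ge0 N.
  move: t1; clear; set a := `|t|; set b := `|N|; set d := `|s|; set z := `|v|.
  move=> a1 b0 a0 d0 h.
  have k1 : a * (d * b) <= d * b by rewrite ler_piMl ?mulr_ge0 // ltW.
  have k2 : a * (a * (d * b)) <= a * (M * b) by rewrite ler_wpM2l // (le_trans k1).
  by nra.
have T1 := taylor_parabola (- N) (c + delta) oU Uq f2 fv e0.
have T2 := taylor_parabola (- N) (c - delta) oU Uq f2 fv e0.
have cb s : s \in `[c - delta, c + delta] -> `|s - c| <= delta /\ `|s| <= M.
  rewrite in_itv /= -ler_distl => h; split => //.
  by rewrite -[s](subrK c) addrC (le_trans (ler_normD _ _)) // lerD2l.
have cG : 'D_v ('D_v f) q / 2 = c * enorm (grad f q).
  by rewrite /c; have h := lt0r_neq0 G0; field.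
apply: filterS3 UM T1 T2 => t tU t1 t2.
have [|||s /cb[sc sM] fs] := @IVT R (fun s => f (y t s)) (c - delta) (c + delta) 0.
- by rewrite lerD2l (le_trans _ (ltW d0)) // oppr_le0 ltW.
- apply: derivable_within_continuous => s /cb[_ /tU Us].
  have k1 : is_derive s (1 : R) (fun s => t ^+ 2 * s) (t ^+ 2 *: (1 : R)).
    exact: is_deriveZ.
  have k2 : is_derive s (1 : R) (y t) (0 + (t ^+ 2 *: (1 : R)) *: (- N)).
    exact: (is_deriveD (is_derive_cst _ _ _) (is_derive_scalel (- N) k1)).
  by have [] := is_derive_curve (C1_differentiable oU Us f1) k2.
- move: t1 t2; rewrite -/(y t (c + delta)) -/(y t (c - delta)) fq fN !subr0 cG.
  rewrite !ler_norml; set A := f _; set B := f _.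
  have := sqr_ge0 t; move: G0 d0; set G := enorm _; set T := t ^+ 2; clear => G0 d0 T0.
  have k : 0 <= T * (delta * G) by apply: mulr_ge0 => //; apply: mulr_ge0; exact: ltW.
  move=> /andP[_ h1] /andP[h2 _].
  have B0 : 0 <= B by lra.
  have A0 : A <= 0 by lra.
  by rewrite ge_min A0 orbT /= le_max B0.
- exists s; split => //; apply/boundary_zero; last first.
    by rewrite -fs /y scalerN.
  by move: (tU s sM); rewrite /y scalerN.
Qed.

Lemma curve_continuous S q v (gamma : R -> V) : curve_through S q v gamma ->
  (gamma @ (0 : R) --> q).
Proof.
by move=> [_ g0 /is_derive_continuous]; rewrite /prop_for /continuous_at g0.
Qed.

(** A vector orthogonal to the gradient is the velocity of a curve made of the
    zeros found along parabolas; the boundedness of s makes the quadratic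
    correction harmless, so no regularity in t is needed. *)
Lemma tangent_boundary q v : U q -> boundary X q ->
  tangent_space (boundary X) q v <-> dot v (grad f q) = 0.
Proof.
move=> Uq bq; have fq := (boundary_zero Uq).1 bq; split=> [[g gc]|vG].
  have gq := curve_continuous gc; have [gb g0 gd] := gc.
  have fd : differentiable f (g 0) by rewrite g0; exact: C1_differentiable oU Uq f1.
  have := is_derive_curve fd gd.
  rewrite g0 (C1_derive _ oU Uq f1) => h.
  have gU : \forall t \near (0 : R), U (g t) by apply: gq; exact: open_nbhs_nbhs.
  have z : \forall t \near (0 : R), (f \o g) t = (cst 0 : R -> R) t.
    by apply: filterS2 gb gU => t bt Ut; exact: (boundary_zero Ut).1.
  have := near_eq_is_derive z h => k.
  rewrite -(@derive_val _ _ _ _ _ _ _ k); exact: derive_cst.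
have := zero_set_parabola Uq fq vG ltr01; set c := _ / _ => zs.
pose P t s := `|s - c| <= 1 /\ boundary X (q + t *: v - (t ^+ 2 * s) *: unit_grad f q).
pose sg t := xget 0 (P t).
have Psg : \forall t \near (0 : R), P t (sg t).
  by apply: filterS zs => t [s st]; apply: xgetPex; exists s.
pose g t := q + t *: v - (t ^+ 2 * sg t) *: unit_grad f q.
exists g; split.
- by apply: filterS Psg => t [].
- by rewrite /g scale0r expr0n /= mul0r scale0r addr0 subr0.
- have k : is_derive (0 : R) (1 : R) (fun t => t ^+ 2 * sg t) 0.
    apply: (@is_derive_quadratic _ _ (`|c| + 1)); first by rewrite expr0n mul0r.
    apply: filterS Psg => t [st _]; rewrite normrM ger0_norm ?sqr_ge0 // mulrC.
    rewrite ler_wpM2r ?sqr_ge0 // -[sg t](subrK c) addrC (le_trans (ler_normD _ _)) //.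
    by rewrite lerD2l.
  have k1 := is_derive_scalel (unit_grad f q) k.
  have := is_deriveB (is_derive_affine q v 0) k1.
  by rewrite scale0r subr0.
Qed.

(** nu q is a multiple of the gradient because it is orthogonal to the tangent
    hyperplane; the sign is fixed by f being negative on X. *)
Lemma outward_normal_grad nu q : outward_unit_normal X nu -> U q ->
  boundary X q -> nu q = unit_grad f q.
Proof.
move=> nuX Uq bq; have [nn nt nX] := nuX q bq.
have fq := (boundary_zero Uq).1 bq.
have G0 : 0 < enorm (grad f q) by rewrite enorm_gt0 grad_neq0.
have GG : 0 < dot (grad f q) (grad f q) by rewrite -enorm_sqr exprn_gt0.
pose k := dot (nu q) (grad f q) / dot (grad f q) (grad f q).
pose w := nu q - k *: grad f q.
have wG : dot w (grad f q) = 0.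
  by rewrite /w !dot_lin divfK ?subrr // lt0r_neq0.
have w0 : w = 0.
  apply/eqP; rewrite -dot_eq0; apply/eqP; rewrite {1}/w.
  by rewrite dotDl dotNl dotZl (nt w) ?(dotC _ w) ?wG ?mulr0 ?subrr //; apply/tangent_boundary.
have nk : nu q = k *: grad f q by apply/eqP; rewrite -subr_eq0; exact/eqP.
have k0 : 0 <= dot (nu q) (grad f q).
  rewrite leNgt; apply/negP => dn.
  have h : is_derive (0 : R) (1 : R) (fun t => f (q + t *: - nu q)) (- dot (nu q) (grad f q)).
    rewrite -dotNl -(C1_derive _ oU Uq f1).
    have := @is_derive_line R V R^o f q (- nu q) 0.
    by rewrite scale0r addr0; apply; have [] := f1 Uq (- nu q).
  have e0 : 0 < - dot (nu q) (grad f q) by rewrite oppr_gt0.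
  have he := is_derive_expand h e0.
  have hc : (fun t => q + t *: - nu q) @ (0 : R) --> q.
    have c : {for 0, continuous (fun t : R => q + t *: - nu q)}.
      exact: continuous_affine.
    by move: c; rewrite /prop_for /continuous_at scale0r addr0.
  have hU : \forall t \near (0 : R), U (q + t *: - nu q).
    by apply: hc; exact: open_nbhs_nbhs.
  near (0 : R)^'+ => t.
  have t0 : 0 < t by near: t; exact: nbhs_right_gt.
  have [Xt _] : X (q - t *: nu q) /\ ~ X (q + t *: nu q) by near: t.
  have Ut : U (q + t *: - nu q).
    by near: t; exact: cvg_within hU.
  have : `|f (q + (t + 0) *: - nu q) - f (q + 0 *: - nu q) - t *: - dot (nu q) (grad f q)| <=
      - dot (nu q) (grad f q) * `|t|.
    by near: t; exact: cvg_within he.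
  rewrite -scalerN in Xt; have := (interior_neg Ut).1 Xt.
  rewrite addr0 scale0r addr0 fq subr0 (gtr0_norm t0) /GRing.scale /= => h1.
  rewrite ler_norml => /andP[h2 _]; nra.
have kG : k * enorm (grad f q) = 1.
  have : (k * enorm (grad f q)) ^+ 2 = 1.
    by rewrite exprMn enorm_sqr -[RHS]nn nk !dot_lin expr2 mulrA.
  move/eqP; rewrite sqrf_eq1 => /orP[/eqP //|/eqP h].
  have : 0 <= k * enorm (grad f q) by rewrite mulr_ge0 ?enorm_ge0 // divr_ge0 // ltW.
  by rewrite h lerNr oppr0 ler10.
by rewrite nk /unit_grad; congr (_ *: _); rewrite -[RHS]mul1r -kG mulfK // lt0r_neq0.
Unshelve. all: by end_near. Qed.

End DefiningFunction.

(** * The second fundamental form *)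

Section SecondFundamentalForm.
Context (R : realType) (n : nat).
Local Notation V := 'rV[R]_n.
Variables (X U : set V) (f : V -> R).
Hypotheses (oU : open U) (fdef : C2_defining_function X U f).
Implicit Types (q v : V).

Let f2 : C2_on U f. Proof. by case: fdef. Qed.
Let f1 : C1_on U f. Proof. by case: f2. Qed.

Lemma differentiable_enorm_inv q : U q -> f q = 0 ->
  differentiable (fun y => (enorm (grad f y))^-1) q.
Proof.
move=> Uq fq; have G0 := grad_neq0 oU fdef Uq fq.
apply: differentiableV; last by rewrite enorm_eq0.
apply: (@differentiable_comp _ _ R^o R^o (fun y => dot (grad f y) (grad f y)) Num.sqrt).
  have -> : (fun y => dot (grad f y) (grad f y)) =
      \sum_i (('D_(basis_vec R i) f : V -> R^o) * 'D_(basis_vec R i) f).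
    by apply/funext => y; rewrite fct_sumE; apply: eq_bigr => i _; rewrite mxE.
  have fd i := C1_differentiable oU Uq (f2.2 (basis_vec R i)).
  by apply: differentiable_sum => i; exact: differentiableM.
apply/derivable1_diffP.
have GG : 0 < dot (grad f q) (grad f q) by rewrite dot_gt0.
by have [] := is_derive1_sqrt GG.
Qed.

Lemma differentiable_unit_grad q : U q -> f q = 0 ->
  differentiable (unit_grad f) q.
Proof.
move=> Uq fq.
have -> : unit_grad f = fun y => \row_i ((enorm (grad f y))^-1 * 'D_(basis_vec R i) f y).
  by apply/funext => y; apply/rowP => i; rewrite !mxE.
apply: differentiable_rows => i; apply: differentiableM.
  exact: differentiable_enorm_inv.
exact: C1_differentiable oU Uq (f2.2 _).
Qed.

Lemma derive_dotl (g : V -> V) q v w : differentiable g q ->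
  'D_v (fun y => dot (g y) w) q = dot ('D_v g q) w.
Proof.
move=> gd; have wc := @continuous_dotr _ _ w.
have wd : differentiable (dotr w : V -> R^o) (g q).
  exact: (@linear_differentiable _ V R^o).
have := differentiable_comp gd wd; rewrite /comp => d.
by rewrite deriveE // (diff_comp gd wd) /= (@diff_lin _ V R^o) // deriveE.
Qed.

(** The derivative of the normalising factor contributes nothing, as w is
    orthogonal to the gradient. *)
Lemma derive_unit_grad q v w : U q -> f q = 0 -> dot w (grad f q) = 0 ->
  dot ('D_v (unit_grad f) q) w = 'D_v ('D_w f) q / enorm (grad f q).
Proof.
move=> Uq fq wG.
rewrite -(derive_dotl _ _ (differentiable_unit_grad Uq fq)).
have kd : derivable (fun y => (enorm (grad f y))^-1) q v.
  exact: diff_derivable (differentiable_enorm_inv Uq fq).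
have fd : derivable ('D_w f) q v by have [] := f2.2 w q Uq v.
rewrite (@near_eq_derive _ _ _ _ ((fun y => (enorm (grad f y))^-1) * 'D_w f)); last first.
  have : nbhs q U by exact: open_nbhs_nbhs.
  apply: filterS => y Uy; rewrite /unit_grad dotZl !fctE /=.
  by rewrite (C1_derive _ oU Uy f1) (dotC w).
rewrite deriveM // (C1_derive w oU Uq f1) wG scale0r addr0.
by rewrite /GRing.scale /= mulrC.
Qed.

(** Near q the normal nu is known only along the boundary, where it agrees with
    the differentiable field unit_grad f. *)
Lemma derivative_along_unit_grad nu q v : outward_unit_normal X nu ->
    U q -> boundary X q -> tangent_space (boundary X) q v ->
  derivative_along (boundary X) nu q v = 'D_v (unit_grad f) q.
Proof.
move=> nuX Uq bq [g0 g0c]; have fq := (boundary_zero fdef Uq).1 bq.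
have nug g : curve_through (boundary X) q v g ->
    is_derive (0 : R) (1 : R) (nu \o g) ('D_v (unit_grad f) q).
  move=> gc; have [gb gq gv] := gc.
  have Nd : differentiable (unit_grad f) (g 0).
    by rewrite gq; exact: differentiable_unit_grad.
  have := is_derive_curve Nd gv; rewrite gq; apply: near_eq_is_derive.
  have gU : \forall t \near (0 : R), U (g t).
    by apply: (curve_continuous gc); exact: open_nbhs_nbhs.
  apply: filterS2 gb gU => t bt Ut /=.
  by rewrite (outward_normal_grad oU fdef nuX Ut bt).
rewrite /derivative_along; case: xgetP => [d _ [g [gc gd]]|/(_ ('D_v (unit_grad f) q)) []].
  rewrite -(@derive_val _ _ _ _ _ _ _ gd); apply: derive_val; exact: nug.
by exists g0; split => //; exact: nug.
Qed.

End SecondFundamentalForm.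

(** To second order the boundary falls below its tangent hyperplane by half the
    second fundamental form. The form is recorded as the restriction of a matrix
    Q on the whole space, namely the derivative of the unit gradient, since this
    makes the trace computable in every frame. *)
Lemma boundary_second_order (R : realType) (n : nat) (X : set 'rV[R]_n) nu p :
    C2_domain X -> outward_unit_normal X nu -> boundary X p ->
  exists Q : 'M[R]_n,
    (forall e, normal_frame (nu p) e ->
      mean_curvature (boundary X) nu p = \sum_i dot (e i *m Q) (e i)) /\
    forall v, dot (nu p) v = 0 -> forall delta : R, 0 < delta ->
      \forall t \near (0 : R), exists s, `|s - dot (v *m Q) v / 2| <= delta /\
        boundary X (p + t *: v - (t ^+ 2 * s) *: nu p).
Proof.
move=> [_ X2] nuX bp; have [U [f [[oU Up] fdef]]] := X2 p bp.
have fp := (boundary_zero fdef Up).1 bp.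
have G0 : 0 < enorm (grad f p) by rewrite enorm_gt0 (grad_neq0 oU fdef).
have np := outward_normal_grad oU fdef nuX Up bp.
have nn : dot (nu p) (nu p) = 1 by have [] := nuX p bp.
have nperp v : dot (nu p) v = 0 <-> dot v (grad f p) = 0.
  rewrite np dotZl dotC; split=> [/eqP|->]; last by rewrite mulr0.
  by rewrite mulf_eq0 invr_eq0 (gt_eqF G0) /= => /eqP.
have tp v : tangent_space (boundary X) p v <-> dot (nu p) v = 0.
  by rewrite (tangent_boundary oU fdef v Up bp) nperp.
pose Q := jacobian (unit_grad f) p; exists Q.
have QE v : v *m Q = 'D_v (unit_grad f) p.
  by rewrite deriveEjacobian //; exact: (differentiable_unit_grad oU fdef Up fp).
split=> [e fe|v nv delta d0].
  have frame e' : orthonormal_tangent_basis (boundary X) p e' -> normal_frame (nu p) e'.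
    by move=> [e't e'e' _]; split => // i; rewrite dotC; exact/tp.
  rewrite (normal_frame_trace Q nn fe) /mean_curvature.
  have h e' : normal_frame (nu p) e' ->
      \sum_i second_fundamental_form (boundary X) nu p (e' i) (e' i)
      = \tr Q - dot (nu p *m Q) (nu p).
    move=> fe'; rewrite -(normal_frame_trace Q nn fe'); apply: eq_bigr => i _.
    rewrite /second_fundamental_form QE.
    rewrite (derivative_along_unit_grad oU fdef nuX Up bp) //.
    by apply/tp; rewrite dotC; case: fe'.
  case: xgetP => [e' _ /frame|/(_ e) []]; first exact: h.
  have [ee en] := fe; split => // [i|v /tp tv]; first by apply/tp; rewrite dotC.
  exists (fun i => dot v (e i)).
  by rewrite {1}(normal_frame_expand v nn fe) dotC tv scale0r add0r.
have := zero_set_parabola oU fdef Up fp ((nperp v).1 nv) d0.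
rewrite QE (derive_unit_grad oU fdef _ Up fp ((nperp v).1 nv)) np.
have -> // : 'D_v ('D_v f) p / enorm (grad f p) / 2
   = 'D_v ('D_v f) p / (2 * enorm (grad f p)).
by have h := lt0r_neq0 G0; field.
Qed.

(** * Components of the boundary *)

Section LocalConnectedness.
Context (R : realType).

Lemma connected_ball (V : normedModType R) (p : V) (r : R) : connected (ball p r).
Proof.
have [r0|r0] := leP r 0.
  have -> : ball p r = set0.
    apply/seteqP; split=> // y; rewrite -ball_normE /=.
    by move=> /(le_lt_trans (normr_ge0 _)); rewrite ltNge r0.
  exact: connected0.
have -> : ball p r = \bigcup_(y in ball p r)
    ((fun t : R => p + t *: (y - p)) @` `[0, 1]).
  apply/seteqP; split=> [y py|x [y py [t]]] /=.
    exists y => //; exists 1; first by rewrite /= in_itv /= ler01 lexx.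
    by rewrite scale1r addrC subrK.
  rewrite in_itv /= => /andP[t0 t1] <-; move: py; rewrite -!ball_normE /=.
  rewrite opprD addrA subrr sub0r normrN normrZ (ger0_norm t0) distrC => yr.
  by apply: le_lt_trans yr; rewrite ler_piMl.
apply: bigcup_connected.
  exists p => y py; exists 0; first by rewrite /= in_itv /= ler01 lexx.
  by rewrite scale0r addr0.
move=> y py; apply: connected_continuous_connected; first exact: segment_connected.
by apply: continuous_subspaceT; exact: continuous_affine.
Qed.

Lemma nbhs_has_ball (V : normedModType R) (p : V) (A : set V) : nbhs p A ->
  exists2 r : R, 0 < r & ball p r `<=` A.
Proof. by move=> /nbhs_ballP[r /= r0 rA]; exists r. Qed.

Lemma cvg_translate (V : normedModType R) (f : V -> R) (p w : V) :
  {for p + w, continuous f} -> f (y + w) @[y --> p] --> f (p + w).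
Proof.
move=> fc; have ca : {for p, continuous (fun y => y + w)}.
  by apply: (@cvgD _ _ _ (nbhs p)); [exact: cvg_id|exact: cvg_cst].
exact: (continuous_comp ca fc).
Qed.

Lemma derive_gt0_incr (V : normedModType R) (f : V -> R) (x e : V) (s t : R) :
    s < t -> (forall c, c \in `[s, t] ->
      derivable f (x + c *: e) e /\ 0 < 'D_e f (x + c *: e)) ->
  f (x + s *: e) < f (x + t *: e).
Proof.
move=> st fd; pose df c := 'D_e f (x + c *: e).
have fline c : c \in `[s, t] -> is_derive c (1 : R) (fun c => f (x + c *: e)) (df c).
  by move=> /fd[fc _]; exact: is_derive_line.
have fc : {within `[s, t], continuous (fun c => f (x + c *: e))}.
  by apply: derivable_within_continuous => c /fline[].
have [c /subset_itv_oo_cc /fd[_ c0]] := MVT st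
  (fun c cst => fline c (subset_itv_oo_cc cst)) fc.
by rewrite -[_ < _]subr_gt0 => ->; rewrite mulr_gt0 // subr_gt0.
Qed.

(** The implicit function theorem in its topological form: if f is strictly
    increasing along e and changes sign within distance rho, its zero on the
    segment through x depends continuously on x, by monotonicity. *)
Lemma zero_set_graph (V : normedModType R) (W : set V) (f : V -> R) (e : V) (rho : R) :
    open W -> connected W -> 0 < rho ->
    (forall x s, W x -> `|s| <= rho -> {for x + s *: e, continuous f}) ->
    (forall x s t, W x -> - rho <= s -> s < t -> t <= rho ->
      f (x + s *: e) < f (x + t *: e)) ->
    (forall x, W x -> f (x - rho *: e) < 0 /\ 0 < f (x + rho *: e)) ->
  exists C, [/\ connected C,
    forall y, C y -> f y = 0 /\ exists x s, [/\ W x, `|s| <= rho & y = x + s *: e] &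
    forall x, W x -> f x = 0 -> C x].
Proof.
move=> oW cW rho0 fc fmono fsgn.
have mono x s t : W x -> - rho <= s -> s <= rho -> - rho <= t -> t <= rho ->
    f (x + s *: e) < f (x + t *: e) -> s < t.
  move=> Wx s1 s2 t1 t2 fst; rewrite ltNge; apply/negP; rewrite le_eqVlt => /orP[/eqP ts|ts].
    by move: fst; rewrite ts ltxx.
  by have := lt_trans fst (fmono x t s Wx t1 ts s2); rewrite ltxx.
have root x : W x -> exists s, [/\ - rho < s, s < rho & f (x + s *: e) = 0].
  move=> Wx; have [fl fr] := fsgn x Wx; rewrite -scaleNr in fl.
  have nr : - rho <= rho by rewrite ge0_cp // ltW.
  have [|| s] := @IVT R (fun s => f (x + s *: e)) (- rho) rho 0 nr.
  - apply: continuous_in_subspaceT => s; rewrite inE /= in_itv /= -ler_norml => sr.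
    exact: (continuous_comp (@continuous_affine _ _ x e s) (fc x s Wx sr)).
  - by rewrite ge_min (ltW fl) le_max (ltW fr) orbT.
  rewrite in_itv /= => /andP[s1 s2] fs; exists s; split => //.
    rewrite lt_neqAle s1 andbT; apply/eqP => h.
    by move: fl; rewrite h fs ltxx.
  rewrite lt_neqAle s2 andbT; apply/eqP => h.
  by move: fr; rewrite -h fs ltxx.
pose P x s := [/\ - rho < s, s < rho & f (x + s *: e) = 0].
pose sg x := xget 0 (P x).
have sgP x : W x -> P x (sg x) by move=> /root ?; exact: xgetPex.
pose phi x := x + sg x *: e.
have csg x : W x -> {for x, continuous sg}.
  move=> Wx; have [s1 s2 fs] := sgP x Wx; apply/cvgrPdist_le => eps eps0.
  pose d := Num.min eps (Num.min (sg x + rho) (rho - sg x)).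
  have d0 : 0 < d by rewrite !lt_min eps0 -ltrBlDr sub0r s1 subr_gt0.
  have /and3P[d1 d2 d3] : [&& d <= eps, d <= sg x + rho & d <= rho - sg x].
    by rewrite !ge_min !lexx !orbT.
  have b1 : - rho <= sg x - d by lra.
  have b2 : sg x + d <= rho by lra.
  have fl : f (x + (sg x - d) *: e) < 0 by rewrite -fs; apply: fmono => //; lra.
  have fr : 0 < f (x + (sg x + d) *: e) by rewrite -fs; apply: fmono => //; lra.
  have tr (c : R) : `|c| <= rho -> (fun y => f (y + c *: e)) @ x --> f (x + c *: e).
    by move=> cr; exact: cvg_translate (fc x c Wx cr).
  have nl : \forall y \near x, f (y + (sg x - d) *: e) < 0.
    by apply: (cvgr_lt _ (tr _ _) 0) => //; rewrite ler_norml; lra.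
  have nr : \forall y \near x, 0 < f (y + (sg x + d) *: e).
    by apply: (cvgr_gt _ (tr _ _) 0) => //; rewrite ler_norml; lra.
  have nW : \forall y \near x, W y by exact: open_nbhs_nbhs.
  apply: filterS3 nl nr nW => y yl yr Wy; have [t1 t2 ft] := sgP y Wy.
  have k1 : sg x - d < sg y by apply: (mono y) => //; rewrite ?ft //; lra.
  have k2 : sg y < sg x + d by apply: (mono y) => //; rewrite ?ft //; lra.
  by rewrite ler_norml; lra.
exists (phi @` W); split.
- apply: connected_continuous_connected => //; apply: continuous_in_subspaceT => x.
  rewrite inE => /csg sx; apply: (@cvgD _ _ _ (nbhs x)); first exact: cvg_id.
  by apply: (@cvgZ _ _ _ (nbhs x)); [exact: sx|exact: cvg_cst].
- move=> _ [x Wx <-]; have [s1 s2 fs] := sgP x Wx; split => //.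
  by exists x, (sg x); split => //; rewrite ler_norml !ltW.
- move=> x Wx fx; exists x => //; rewrite /phi.
  have [s1 s2 fs] := sgP x Wx; have f0 : f (x + 0 *: e) = 0 by rewrite scale0r addr0.
  have [sg0|sg0|->] := ltgtP (sg x) 0; last by rewrite scale0r addr0.
  + by have := fmono x (sg x) 0 Wx (ltW s1) sg0 (ltW rho0); rewrite fs f0 ltxx.
  + have := fmono x 0 (sg x) Wx _ sg0 (ltW s2).
    by rewrite fs f0 ltxx oppr_le0 => /(_ (ltW rho0)).
Qed.

End LocalConnectedness.

Lemma closed_boundary (T : topologicalType) (X : set T) : closed (boundary X).
Proof.
rewrite /boundary setDE; apply: closedI; first exact: closed_closure.
by apply: open_closedC; exact: open_interior.
Qed.

(** Near p the boundary is a graph over a ball in the direction of the gradient,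
    along which f is increasing. *)
Lemma boundary_locally_connected (R : realType) (n : nat) (X : set 'rV[R]_n) p :
    C2_domain X -> boundary X p ->
  exists W C, [/\ nbhs p W, connected C, C `<=` boundary X &
    boundary X `&` W `<=` C].
Proof.
move=> [_ X2] bp; have [U [f [[oU Up] fdef]]] := X2 p bp.
have [[f1 _] _ _ reg] := fdef; have fp := (boundary_zero fdef Up).1 bp.
pose e := grad f p.
have fe : 0 < 'D_e f p.
  by rewrite (C1_derive _ oU Up f1) dot_gt0 (grad_neq0 oU fdef).
have [r [r0 rU]] : exists r : R, 0 < r /\ forall y, ball p r y -> U y /\ 0 < 'D_e f y.
  have [_ ce] := f1 p Up e.
  have n1 : \forall y \near p, 0 < 'D_e f y by exact: (cvgr_gt _ ce 0).
  have n2 : nbhs p U by exact: open_nbhs_nbhs.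
  by have [r r0 h] := nbhs_has_ball (filterI n2 n1); exists r; split.
(* moving by at most rho e changes a point by at most r / 2 *)
pose rho := r / 2 / (`|e| + 1).
have e1 : 0 < `|e| + 1 by rewrite ltr_wpDl.
have rho0 : 0 < rho by rewrite !divr_gt0.
have rs x s : ball p (r / 2) x -> `|s| <= rho -> ball p r (x + s *: e).
  rewrite -!ball_normE /= => px sr; rewrite opprD addrA.
  apply: (le_lt_trans (ler_normB _ _)); rewrite normrZ (splitr r) ltr_leD //.
  apply: (@le_trans _ _ (rho * (`|e| + 1))); last by rewrite divfK ?lt0r_neq0.
  by rewrite ler_pM // lerDl.
have fcont y : ball p r y -> {for y, continuous f}.
  move=> /rU[Uy _]; apply: differentiable_continuous.
  exact: C1_differentiable oU Uy f1.
have fmono x s t : ball p (r / 2) x -> - rho <= s -> s < t -> t <= rho ->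
    f (x + s *: e) < f (x + t *: e).
  move=> px s1 st t1.
  have ball_st c : c \in `[s, t] -> ball p r (x + c *: e).
    rewrite in_itv /= => /andP[c1 c2]; apply: rs => //; rewrite ler_norml; lra.
  apply: derive_gt0_incr => // c cst; have [Uc c0] := rU _ (ball_st c cst).
  by split => //; have [] := f1 _ Uc e.
have pp : ball p (r / 2) p by apply: ballxx; rewrite divr_gt0.
have rr : - rho <= rho by rewrite ge0_cp // ltW.
have fm : f (p - rho *: e) < 0.
  have := fmono p (- rho) 0 pp (lexx _) _ (ltW rho0).
  by rewrite scale0r addr0 fp scaleNr oppr_lt0; apply.
have fq : 0 < f (p + rho *: e).
  have := fmono p 0 rho pp _ rho0 (lexx _).
  by rewrite scale0r addr0 fp oppr_le0; apply; exact: ltW.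
have tr (c : R) : `|c| <= rho -> (fun y => f (y + c *: e)) @ p --> f (p + c *: e).
  by move=> cr; exact: cvg_translate (fcont _ (rs p c pp cr)).
have n1 : \forall y \near p, f (y + - rho *: e) < 0.
  apply: (cvgr_lt _ (tr _ _) 0); last by rewrite scaleNr.
  by rewrite normrN gtr0_norm.
have n2 : \forall y \near p, 0 < f (y + rho *: e).
  by apply: (cvgr_gt _ (tr _ _) 0) => //; rewrite gtr0_norm.
have n3 : nbhs p (ball p (r / 2)) by apply: nbhsx_ballx; rewrite divr_gt0.
have [d d0 dsub] := nbhs_has_ball (filterI (filterI n1 n2) n3).
have dball y : ball p d y ->
    [/\ f (y - rho *: e) < 0, 0 < f (y + rho *: e) & ball p (r / 2) y].
  by move=> /dsub[[y1 y2] y3]; rewrite -scaleNr.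
have oB : open (ball p d) by exact: ball_open.
have [C [cC C1 C2]] : exists C, [/\ connected C,
    forall y, C y -> f y = 0 /\
      exists x s, [/\ ball p d x, `|s| <= rho & y = x + s *: e] &
    forall x, ball p d x -> f x = 0 -> C x].
  apply: (zero_set_graph oB (@connected_ball _ _ p d) rho0).
  - by move=> x s /dball[_ _ xr] sr; exact/fcont/rs.
  - by move=> x s t /dball[_ _ xr]; exact: fmono.
  - by move=> x /dball[x1 x2 _].
exists (ball p d), C; split => //.
- exact: nbhsx_ballx.
- move=> y /C1[fy [x [s [/dball[_ _ xr] sr ye]]]].
  have [Uy _] : U y /\ 0 < 'D_e f y by rewrite ye; exact/rU/rs.
  exact/(boundary_zero fdef Uy).
- move=> y [bY yd]; have [_ _ yr] := dball y yd; apply: C2 => //.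
  have z0 : `|0 : R| <= rho by rewrite normr0 ltW.
  have [Uy _] := rU _ (rs y 0 yr z0); rewrite scale0r addr0 in Uy.
  exact: (boundary_zero fdef Uy).1.
Qed.

(** Components of a locally connected space are open: a small connected piece of
    the boundary around a limit of points outside the component lies entirely
    outside it. *)
Lemma boundary_component_complement_closed (R : realType) (n : nat)
    (X : set 'rV[R]_n) p : C2_domain X ->
  closed (boundary X `\` connected_component (boundary X) p).
Proof.
move=> X2 y cy; have by_ : boundary X y.
  by apply: closed_boundary; move: cy; apply: closureS => z [].
split => // py; have [W [C [nW cC CX CW]]] := boundary_locally_connected X2 by_.
have Cy : C y by apply: CW; split => //; exact: nbhs_singleton.
have [z [[bz nz] Wz]] := cy W nW; apply: nz.
apply: (connected_component_trans py); exists C => //; exact: CW.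
Qed.

(** * The set equidistant from two parts of the boundary *)

Section Equidistant.
Context (R : realType) (n : nat).
Local Notation V := 'rV[R]_n.
Implicit Types (X S : set V) (z p q w : V).

Lemma closure_open_boundary X z : open X -> closure X z -> X z \/ boundary X z.
Proof.
move=> oX cz; have [Xz|nX] := pselect (X z); first by left.
by right; split => // /interior_subset.
Qed.

Lemma connected_inside X C z : open X -> connected C -> C z -> X z ->
  (forall y, C y -> ~ boundary X y) -> C `<=` X.
Proof.
move=> oX cC Cz Xz Cb; suff <- : C `&` X = C by move=> y [].
apply: cC; first by exists z.
  by exists X.
exists (closure X); first exact: closed_closure.
apply/seteqP; split=> y [Cy h]; split => //; first exact: subset_closure.
by have [//|/(Cb y Cy)] := closure_open_boundary oX h.
Qed.

Lemma open_enorm_ball X z : open X -> X z ->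
  exists2 r : R, 0 < r & forall w, enorm (w - z) < r -> X w.
Proof.
move=> oX Xz; have [r r0 rX] := nbhs_has_ball (open_nbhs_nbhs (conj oX Xz)).
exists r => // w wz; apply: rX; rewrite -ball_normE /= distrC.
exact: le_lt_trans (norm_le_enorm _) wz.
Qed.

(** Before its end the segment is too close to z to reach the boundary, and a
    connected set that meets X but not its boundary stays in X. *)
Lemma segment_to_nearest X z p s : open X -> X z ->
    (forall y, boundary X y -> enorm (z - p) <= enorm (z - y)) ->
  0 <= s -> s < 1 -> X (z + s *: (p - z)).
Proof.
move=> oX Xz near_p s0 s1.
have [->|zp] := eqVneq p z; first by rewrite subrr scaler0 addr0.
have d0 : 0 < enorm (z - p) by rewrite enorm_gt0 subr_eq0 eq_sym.
apply: (@connected_inside X ((fun t : R => z + t *: (p - z)) @` `[0, s]) z) => //.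
- apply: connected_continuous_connected; first exact: segment_connected.
  by apply: continuous_subspaceT; exact: continuous_affine.
- by exists 0; [rewrite /= in_itv /= lexx|rewrite scale0r addr0].
- move=> _ [t /= /[!in_itv] /= /andP[t0 ts] <-] /near_p.
  rewrite opprD addrA subrr sub0r enormN enormZ (enormB p) (ger0_norm t0).
  by apply/negP; rewrite -ltNge gtr_pMl // (le_lt_trans ts).
- by exists s => //; rewrite /= in_itv /= s0 lexx.
Qed.

(** The hypotheses force equality in the triangle inequality for z, the point
    moved towards p, and q, so that q lies on the ray from z through p. *)
Lemma nearest_point_unique z p q s :
    0 < s -> s < 1 -> enorm (z - p) <= enorm (z - q) ->
    enorm (z + s *: (p - z) - q) <= (1 - s) * enorm (z - p) ->
  q = p.
Proof.
move=> s0 s1; set d := enorm (z - p) => dq yq.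
have d0 : 0 <= d by exact: enorm_ge0.
pose a := z - p; have aE : a = z - p by [].
have dd : dot a a = d ^+ 2 by rewrite enorm_sqr.
set y := z + s *: (p - z) - q in yq *.
have yE : y = z + s *: (p - z) - q by [].
have zq : z - q = s *: a + y.
  by rewrite yE aE; apply/rowP => i; rewrite !mxE; ring.
have zq2 : enorm (z - q) ^+ 2 = dot (s *: a + y) (s *: a + y).
  by rewrite enorm_sqr zq.
clearbody a y.
have h1 : dot y y <= (1 - s) ^+ 2 * d ^+ 2.
  rewrite -enorm_sqr -exprMn ler_pXn2r ?nnegrE ?enorm_ge0 //.
  by apply: mulr_ge0 => //; rewrite subr_ge0 ltW.
have h2 : d ^+ 2 <= s ^+ 2 * d ^+ 2 + 2 * s * dot a y + dot y y.
  have : d ^+ 2 <= enorm (z - q) ^+ 2 by rewrite ler_pXn2r ?nnegrE ?enorm_ge0.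
  rewrite zq2 !(dotDl, dotDr, dotZl, dotZr) dd (dotC y) => h.
  by move: h; clear; lra.
have h3 : dot (y - (1 - s) *: a) (y - (1 - s) *: a) <= 0.
  rewrite dotDl !dotDr !(dotNl, dotNr, dotZl, dotZr) dd (dotC y).
  have : (1 - s) * d ^+ 2 <= dot a y.
    by rewrite -(ler_pM2l s0); move: h1 h2; clear; lra.
  rewrite -(@ler_pM2l _ (1 - s)) ?subr_gt0 //.
  by move: h1; clear; lra.
have /eqP : dot (y - (1 - s) *: a) (y - (1 - s) *: a) = 0.
  by apply/eqP; rewrite eq_le h3 dot_ge0.
rewrite dot_eq0 => /eqP e.
have -> : q = p - (y - (1 - s) *: a); last by rewrite e subr0.
by rewrite yE aE; apply/rowP => i; rewrite !mxE; ring.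
Qed.

(** With v = p - z this compares, before and after moving z towards p by the
    fraction s, the squared distance to p plus the penalty. *)
Lemma shrink_estimate z v (tau s : R) :
    0 <= tau -> 0 <= s -> s * (1 + tau) <= 1 / 2 ->
    4 * (tau * enorm z) <= 3 * enorm v ->
  (1 - s) ^+ 2 * enorm v ^+ 2 + tau * dot (z + s *: v) (z + s *: v) <=
    dot v v + tau * dot z z.
Proof.
move=> tau0 s0 st tz; rewrite !dot_lin (dotC v z) -!enorm_sqr.
have := dot_le z v; have := enorm_ge0 v; have := enorm_ge0 z.
move: tz; set a := enorm z; set b := enorm v; set c := dot z v.
move=> tz a0 b0 cab.
have h1 : tau * c <= tau * a * b by rewrite -mulrA ler_wpM2l.
have h2 : tau * a * b <= 3 / 4 * b * b by rewrite ler_wpM2r //; lra.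
have h3 : s * (tau * c) <= s * (3 / 4 * b * b) by rewrite ler_wpM2l // (le_trans h1).
have h4 : s * (1 + tau) * (s * b * b) <= 1 / 2 * (s * b * b).
  by rewrite ler_wpM2r // mulr_ge0 // mulr_ge0.
by move: h3 h4; clear; lra.
Qed.

Definition equidistant X S S' : set V :=
  [set z | closure X z /\ edist S z = edist S' z].

Variables (X S S' : set V).
Hypotheses (oX : open X) (cS : closed S) (cS' : closed S').
Hypotheses (S0 : S !=set0) (S'0 : S' !=set0).
Hypotheses (SS' : forall y, S y -> S' y -> False).
Hypothesis bX : forall y, boundary X y <-> S y \/ S' y.

Lemma equidistant_interior z : equidistant X S S' z -> X z /\ 0 < edist S z.
Proof.
move=> [cz e]; have nS : ~ S z.
  move=> Sz; have nS' : ~ S' z by exact: SS'.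
  by have := edist_gt0 cS' S'0 nS'; rewrite -e edist_mem // ltxx.
split; last exact: edist_gt0.
have [//|/bX[//|S'z]] := closure_open_boundary oX cz.
by have := edist_gt0 cS S0 nS; rewrite e edist_mem // ltxx.
Qed.

Lemma equidistant_closed : closed (equidistant X S S').
Proof.
have -> : equidistant X S S' =
    closure X `&` (fun z => edist S z - edist S' z) @^-1` [set 0].
  apply/seteqP; split=> z [cz e]; split => //=; first by rewrite e subrr.
  by apply/eqP; rewrite -subr_eq0; exact/eqP.
apply: closedI; first exact: closed_closure.
apply: closed_comp; last exact: closed_eq.
move=> z _; apply: (@cvgB _ _ _ (nbhs z)); exact: continuous_edist.
Qed.

(** Points of X near S are closer to S, points near S' are closer to S', and X
    is connected. *)
Lemma equidistant_nonempty : connected X -> equidistant X S S' !=set0.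
Proof.
move=> cX; pose g z := edist S z - edist S' z.
have gc : continuous g.
  by move=> z; apply: (@cvgB _ _ _ (nbhs z)); exact: continuous_edist.
have [p Sp] := S0; have [q S'q] := S'0.
have gp : g p < 0.
  by rewrite /g edist_mem // sub0r oppr_lt0 edist_gt0 // => /(SS' Sp).
have gq : 0 < g q.
  by rewrite /g (edist_mem S'q) subr0 edist_gt0 // => /SS' /(_ S'q).
have [cp _] := (bX p).2 (or_introl Sp); have [cq _] := (bX q).2 (or_intror S'q).
have [x [Xx gx]] := cp _ (cvgr_lt _ (gc p) _ gp).
have [y [Xy gy]] := cq _ (cvgr_gt _ (gc q) _ gq).
have /connected_intervalP gi : connected (g @` X).
  by apply: connected_continuous_connected => //; exact: continuous_subspaceT.
have [z Xz gz] : (g @` X) 0.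
  by apply: (gi (g x) (g y)); [exists x|exists y|rewrite !ltW].
exists z; split; first exact: subset_closure.
by apply/eqP; rewrite -subr_eq0; exact/eqP.
Qed.

End Equidistant.

(** Sliding w from zh towards ph shortens the distance at unit relative speed,
    while the penalty tau |w|^2 grows at a smaller rate. So if S' is nearer to zh
    than S is, sliding to the first equidistant point, which is met soon since
    S is strictly nearer to the points of the segment from z to p, only lowers
    the functional that z minimises. *)
Lemma equidistant_min_side (R : realType) (n : nat) (X S S' : set 'rV[R]_n)
    z p (tau : R) (d := edist S z) :
    open X -> closed S -> closed S' -> S !=set0 -> S' !=set0 ->
    (forall y, S y -> S' y -> False) ->
    (forall y, boundary X y <-> S y \/ S' y) ->
    equidistant X S S' z -> S p -> enorm (z - p) = d ->
    0 <= tau -> 4 * (tau * enorm z) <= d ->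
    (forall w, equidistant X S S' w ->
      d ^+ 2 + tau * dot z z <= edist S w ^+ 2 + tau * dot w w) ->
  exists2 r : R, 0 < r & forall zh ph, enorm (zh - z) < r -> enorm (ph - p) < r ->
    S ph -> edist S' zh <= edist S zh ->
    d ^+ 2 + tau * dot z z <= dot (zh - ph) (zh - ph) + tau * dot zh zh.
Proof.
move=> oX cS cS' S0 S'0 SS' bX Mz Sp zp tau0 tz minz.
have [Xz d0] := equidistant_interior oX cS cS' S0 S'0 SS' bX Mz.
rewrite -/d in d0; have [_ duv] := Mz; rewrite -/d in duv.
have [r0 r00 rX] := open_enorm_ball oX Xz.
(* the first bound on the sliding time is the one of shrink_estimate, the second
   keeps the slid point within r0 of z, hence in X *)
pose sg := Num.min (1 / (2 * (1 + tau))) (r0 / (4 * d)).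
have t1 : 0 < 1 + tau by rewrite ltr_wpDr.
have sg0 : 0 < sg by rewrite lt_min !divr_gt0 ?mulr_gt0.
have sg1 : sg * (1 + tau) <= 1 / 2.
  rewrite -ler_pdivlMr // ge_min; apply/orP; left.
  by rewrite le_eqVlt; apply/orP; left; apply/eqP; field; exact: lt0r_neq0.
have sgd : sg * d <= r0 / 4.
  rewrite -ler_pdivlMr // ge_min; apply/orP; right.
  by rewrite le_eqVlt; apply/orP; left; apply/eqP; field; exact: lt0r_neq0.
have sglt : sg < 1.
  have := mulr_ge0 (ltW sg0) tau0; move: sg1; rewrite mulrDr mulr1; clear; lra.
(* y0 is the limit position at time sg; there S is strictly nearer than S' *)
pose y0 := z + sg *: (p - z).
have uy0 : edist S y0 <= (1 - sg) * d.
  apply: le_trans (edist_le _ Sp) _.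
  have -> : y0 - p = (1 - sg) *: (z - p).
    by apply/rowP => i; rewrite !mxE; ring.
  by rewrite enormZ zp ger0_norm // subr_ge0 ltW.
have gap : edist S y0 < edist S' y0.
  apply: le_lt_trans uy0 _; rewrite ltNge; apply/negP.
  have [q S'q ->] := edist_attained y0 cS' S'0 => yq.
  have qp : q = p.
    apply: (@nearest_point_unique _ _ z p q sg sg0 sglt); last by rewrite zp.
    by rewrite zp duv; exact: edist_le.
  by apply: (SS' p Sp); rewrite -qp.
pose eta := edist S' y0 - edist S y0.
have eta0 : 0 < eta by rewrite subr_gt0.
have [r [r_gt0 r1 r2 r3]] : exists r : R, [/\ 0 < r, 2 * r <= eta, 2 * r <= r0 &
    r * (2 * tau + 3) <= d].
  pose c := Num.min (eta / 2) (Num.min (r0 / 2) (d / (2 * tau + 3))).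
  have t3 : 0 < 2 * tau + 3 by move: tau0; clear; lra.
  exists c; split; first by rewrite !lt_min !divr_gt0.
  - by rewrite mulrC -ler_pdivlMr // ge_min lexx.
  - by rewrite mulrC -ler_pdivlMr // !ge_min lexx orbT.
  - by rewrite -ler_pdivlMr // !ge_min lexx !orbT.
exists r => // zh ph zhr phr Sph zhuv.
pose w s := zh + s *: (ph - zh).
have wz s : 0 <= s -> s <= 1 -> enorm (w s - (z + s *: (p - z))) < r.
  move=> s0 s1.
  have -> : w s - (z + s *: (p - z)) = (1 - s) *: (zh - z) + s *: (ph - p).
    by apply/rowP => i; rewrite !mxE; ring.
  apply: (le_lt_trans (enorm_triangle _ _)); rewrite !enormZ (ger0_norm s0).
  rewrite ger0_norm ?subr_ge0 //; pose m := Num.max (enorm (zh - z)) (enorm (ph - p)).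
  have mr : m < r by rewrite gt_max zhr phr.
  apply: le_lt_trans mr; have -> : m = (1 - s) * m + s * m by ring.
  by apply: lerD; apply: ler_wpM2l; rewrite ?subr_ge0 // le_max lexx ?orbT.
have [s ssg ws] : exists2 s, s \in `[0, sg] & edist S (w s) - edist S' (w s) = 0.
  apply: IVT; first exact: ltW.
    apply: continuous_subspaceT => s.
    have ws := @continuous_affine R _ zh (ph - zh) s.
    have us := continuous_comp ws (@continuous_edist _ _ S cS S0 (w s)).
    have vs := continuous_comp ws (@continuous_edist _ _ S' cS' S'0 (w s)).
    exact: (@cvgB _ _ _ (nbhs s) _ _ _ _ _ us vs).
  have w0 : 0 <= edist S (w 0) - edist S' (w 0).
    by rewrite /w scale0r addr0 subr_ge0.
  have w1 : edist S (w sg) - edist S' (w sg) <= 0.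
    have h := wz sg (ltW sg0) (ltW sglt); rewrite -/y0 in h.
    have e1 := edist_lip (w sg) y0 cS S0; have e2 := edist_lip y0 (w sg) cS' S'0.
    rewrite (enormB y0) in e2; move: r1 h e1 e2; rewrite /eta.
    move: (edist S (w sg)) (edist S' (w sg)) (edist S y0) (edist S' y0) (enorm _).
    by clear; move=> *; lra.
  apply/andP; split; first by rewrite ge_min; apply/orP; right; exact: w1.
  by rewrite le_max; apply/orP; left; exact: w0.
move: ssg; rewrite in_itv /= => /andP[s0 ssg].
have s1 : s <= 1 by rewrite (le_trans ssg) // ltW.
have Xw : X (w s).
  apply: rX; have -> : w s - z = (w s - (z + s *: (p - z))) + s *: (p - z).
    by apply/rowP => i; rewrite !mxE; ring.
  apply: (le_lt_trans (enorm_triangle _ _)); have := wz s s0 s1.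
  rewrite enormZ (ger0_norm s0) enormB zp.
  have : s * d <= r0 / 4 by rewrite (le_trans _ sgd) // ler_wpM2r // ltW.
  by move: r2 r00; clear; lra.
have Mw : equidistant X S S' (w s).
  split; first exact: subset_closure.
  by apply/eqP; rewrite -subr_eq0; exact/eqP.
apply: (le_trans (minz _ Mw)).
have uw : edist S (w s) <= (1 - s) * enorm (ph - zh).
  apply: le_trans (edist_le _ Sph) _.
  have -> : w s - ph = (1 - s) *: (zh - ph).
    by apply/rowP => i; rewrite !mxE; ring.
  by rewrite enormZ ger0_norm ?subr_ge0 // enormB.
have -> : dot (zh - ph) (zh - ph) = dot (ph - zh) (ph - zh).
  by rewrite -!enorm_sqr enormB.
apply: le_trans (shrink_estimate tau0 s0 _ _).
- rewrite lerD2r -exprMn ler_pXn2r ?nnegrE ?edist_ge0 //.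
  by rewrite mulr_ge0 ?enorm_ge0 // subr_ge0.
- by rewrite (le_trans _ sg1) // ler_wpM2r // ltW.
- have k1 : enorm zh <= enorm z + r.
    by rewrite -[X in enorm X](subrK z) addrC (le_trans (enorm_triangle _ _)) // lerD2l ltW.
  have k2 : d <= enorm (ph - zh) + 2 * r.
    rewrite -zp enormB; have -> : p - z = (ph - zh) + ((zh - z) - (ph - p)).
      by apply/rowP => i; rewrite !mxE; ring.
    apply: (le_trans (enorm_triangle _ _)); rewrite lerD2l.
    apply: (le_trans (enorm_triangle _ _)); rewrite enormN.
    by move: zhr phr; clear; lra.
  have : tau * enorm zh <= tau * enorm z + tau * r by rewrite -mulrDr ler_wpM2l.
  have : 0 <= tau * r by rewrite mulr_ge0 // ltW.
  by move: tz r3 k2 r_gt0; rewrite mulrDr; clear; lra.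
Qed.

(** * Links: two nearest boundary points of an equidistant point *)

(** The broken segment from p through z to q cannot be improved: moving its
    vertex and its ends along the boundary does not lower the square of the
    longer half plus tau |z|^2. *)
Definition minimal_link (R : realType) (n : nat) (X : set 'rV[R]_n)
    (z p q : 'rV[R]_n) (tau : R) : Prop :=
  exists2 r : R, 0 < r & forall zh ph qh,
    enorm (zh - z) < r -> enorm (ph - p) < r -> enorm (qh - q) < r ->
    boundary X ph -> boundary X qh ->
    dot (z - p) (z - p) + tau * dot z z <=
      Num.max (dot (zh - ph) (zh - ph)) (dot (zh - qh) (zh - qh))
      + tau * dot zh zh.

(** Whichever of S and S' is farther from the moved vertex, sliding towards it
    gives the estimate. *)
Lemma equidistant_min_link (R : realType) (n : nat) (X S S' : set 'rV[R]_n)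
    z p q (tau : R) (d := edist S z) :
    open X -> closed S -> closed S' -> S !=set0 -> S' !=set0 ->
    (forall y, S y -> S' y -> False) ->
    (forall y, boundary X y <-> S y \/ S' y) ->
    equidistant X S S' z -> S p -> enorm (z - p) = d -> S' q -> enorm (z - q) = d ->
    0 <= tau -> 4 * (tau * enorm z) <= d ->
    (forall w, equidistant X S S' w ->
      d ^+ 2 + tau * dot z z <= edist S w ^+ 2 + tau * dot w w) ->
  minimal_link X z p q tau.
Proof.
move=> oX cS cS' S0 S'0 SS' bX Mz Sp zp S'q zq tau0 tz minz.
have S'S y : S' y -> S y -> False by move=> S'y Sy; exact: SS' Sy S'y.
have bX' y : boundary X y <-> S' y \/ S y by rewrite bX; split=> -[]; tauto.
have de : edist S' z = d by case: Mz.
have Mz' : equidistant X S' S z by case: Mz.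
have [r1 r1_gt0 h1] := equidistant_min_side oX cS cS' S0 S'0 SS' bX Mz Sp zp tau0 tz minz.
have [r2 r2_gt0 h2] : exists2 r : R, 0 < r & forall zh qh, enorm (zh - z) < r ->
    enorm (qh - q) < r -> S' qh -> edist S zh <= edist S' zh ->
    edist S' z ^+ 2 + tau * dot z z <= dot (zh - qh) (zh - qh) + tau * dot zh zh.
  apply: (equidistant_min_side oX cS' cS S'0 S0 S'S bX' Mz') => //; rewrite ?de //.
  by move=> w [cw e]; rewrite e; apply: minz.
have [r3 r3_gt0 h3] : exists2 r : R, 0 < r & forall y, enorm (y - p) < r -> ~ S' y.
  by apply: (@open_enorm_ball _ _ (~` S')); [exact: closed_openC|exact: SS'].
have [r4 r4_gt0 h4] : exists2 r : R, 0 < r & forall y, enorm (y - q) < r -> ~ S y.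
  by apply: (@open_enorm_ball _ _ (~` S)); [exact: closed_openC|exact: S'S].
exists (Num.min (Num.min r1 r2) (Num.min r3 r4)).
  by rewrite !lt_min r1_gt0 r2_gt0 r3_gt0.
move=> zh ph qh; rewrite !lt_min => /andP[/andP[z1 z2] _].
move=> /andP[/andP[p1 _] /andP[p3 _]] /andP[/andP[_ q2] /andP[_ q4]].
move=> /bX[Sph|/(h3 _ p3)[]] /bX[/(h4 _ q4)[]|S'qh].
rewrite -[dot (z - p) _]enorm_sqr zp.
have [uv|/ltW vu] := leP (edist S' zh) (edist S zh).
  by rewrite (le_trans (h1 _ _ z1 p1 Sph uv)) // lerD2r le_max lexx.
by rewrite -de (le_trans (h2 _ _ z2 q2 S'qh vu)) // lerD2r le_max lexx orbT.
Qed.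

Section SignsOfQuadratics.
Context (R : realType).

Lemma near0_interval (P : R -> Prop) : (\forall t \near (0 : R), P t) ->
  exists2 r : R, 0 < r & forall t, `|t| < r -> P t.
Proof.
move=> /nbhs_has_ball[r r0 h]; exists r => // t tr; apply: h.
by rewrite -ball_normE /= sub0r normrN.
Qed.

Lemma linear_coef_eq0 (A C : R) :
  (\forall t \near (0 : R), 0 <= t * A + t ^+ 2 * C) -> A = 0.
Proof.
move=> /near0_interval[r r0 h].
have C1 : 0 < `|C| + 1 by rewrite ltr_wpDl.
have A_le (eps : R) : 0 < eps -> `|A| <= eps.
  move=> eps0; pose t := Num.min (r / 2) (eps / (`|C| + 1)).
  have t0 : 0 < t by rewrite lt_min !divr_gt0.
  have tr : t < r by rewrite gt_min; apply/orP; left; rewrite ltr_pdivrMr // mulr_natr mulr2n ltrDl.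
  have tC : t * C <= eps.
    apply: (@le_trans _ _ (t * (`|C| + 1))).
      by rewrite ler_wpM2l ?(ltW t0) // ler_wpDr // ler_norm.
    by rewrite -ler_pdivlMr // ge_min lexx orbT.
  have := h t; have := h (- t); rewrite normrN gtr0_norm // => /(_ tr) hm /(_ tr) hp.
  have hp' : 0 <= A + t * C by rewrite -(pmulr_rge0 _ t0); move: hp; lra.
  have hm' : 0 <= - A + t * C by rewrite -(pmulr_rge0 _ t0); move: hm; lra.
  by rewrite ler_norml; lra.
apply/eqP; rewrite -normr_eq0 eq_le normr_ge0 andbT.
by apply/ler_addgt0Pl => e e0; rewrite addr0; exact: A_le.
Qed.

(** Adding the inequalities at t and at - t removes the linear term. *)
Lemma quadratic_coef_ge0 (A K C : R) :
  (\forall t \near (0 : R), 0 <= t * A + t ^+ 2 * K + `|t| ^+ 3 * C) -> 0 <= K.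
Proof.
move=> /near0_interval[r r0 h].
have C1 : 0 < `|C| + 1 by rewrite ltr_wpDl.
apply/ler_addgt0Pl => eps eps0; pose t := Num.min (r / 2) (eps / (`|C| + 1)).
have t0 : 0 < t by rewrite lt_min !divr_gt0.
have tr : t < r by rewrite gt_min; apply/orP; left; rewrite ltr_pdivrMr // mulr_natr mulr2n ltrDl.
have tC : t * C <= eps.
  apply: (@le_trans _ _ (t * (`|C| + 1))).
    by rewrite ler_wpM2l ?(ltW t0) // ler_wpDr // ler_norm.
  by rewrite -ler_pdivlMr // ge_min lexx orbT.
have := h t; have := h (- t); rewrite normrN gtr0_norm // => /(_ tr) hm /(_ tr) hp.
have t2 : 0 < t ^+ 2 by rewrite exprn_gt0.
suff : 0 <= K + t * C by move=> k; apply: le_trans k _; rewrite addrC lerD2r.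
by rewrite -(pmulr_rge0 _ t2); move: hm hp; lra.
Qed.

End SignsOfQuadratics.

(** The sphere around z through p touches the boundary at p from the inside: any
    tangential component of z - p would let boundary points come closer to z, and
    the segment from z to p lies in X, which fixes the sign. *)
Lemma nearest_normal (R : realType) (n : nat) (X : set 'rV[R]_n) nu z p :
    C2_domain X -> outward_unit_normal X nu -> X z -> boundary X p ->
    (forall y, boundary X y -> enorm (z - p) <= enorm (z - y)) ->
  z - p = - enorm (z - p) *: nu p.
Proof.
move=> X2 nuX Xz bp near_p; have oX : open X by case: X2.
have [Q [_ hQ]] := boundary_second_order X2 nuX bp.
have [nn _ nX] := nuX p bp.
pose w := z - p; have wE : w = z - p by [].
have perp v : dot (nu p) v = 0 -> dot w v = 0.
  move=> nv; pose M := `|dot (v *m Q) v / 2| + 1.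
  have M0 : 0 <= M by rewrite addr_ge0.
  pose C := dot v v + 2 * (M * `|dot w (nu p)|) + M ^+ 2.
  suff /linear_coef_eq0 : \forall t \near (0 : R), 0 <= t * (- 2 * dot w v) + t ^+ 2 * C.
    by move=> /eqP; rewrite mulf_eq0 oppr_eq0 pnatr_eq0 => /eqP.
  have n1 : \forall t \near (0 : R), `|t| < 1.
    by apply/nbhs_ballP; exists 1 => //= t; rewrite -ball_normE /= sub0r normrN.
  apply: filterS2 n1 (hQ v nv 1 ltr01) => t t1 [s [sb /near_p]].
  have sM : `|s| <= M.
    rewrite -[s](subrK (dot (v *m Q) v / 2)) (le_trans (ler_normD _ _)) //.
    by rewrite /M addrC lerD2l.
  rewrite -(@ler_pXn2r _ 2%N) ?nnegrE ?enorm_ge0 // !enorm_sqr -wE.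
  have -> : z - (p + t *: v - (t ^+ 2 * s) *: nu p) = w - (t *: v - (t ^+ 2 * s) *: nu p).
    by rewrite wE; apply/rowP => i; rewrite !mxE; ring.
  clearbody w; rewrite !dot_lin nn (dotC v (nu p)) nv (dotC v w) (dotC (nu p) w).
  have sw : s * dot w (nu p) <= M * `|dot w (nu p)|.
    by rewrite (le_trans (ler_norm _)) // normrM ler_wpM2r.
  have s2 : s ^+ 2 <= M ^+ 2 by rewrite -(real_normK (num_real s)) ler_pXn2r ?nnegrE.
  have t2 : t ^+ 2 * s ^+ 2 <= M ^+ 2.
    apply: le_trans s2; rewrite ler_piMl ?sqr_ge0 //.
    by rewrite -(real_normK (num_real t)) expr_le1 // ltW.
  have k1 := ler_wpM2l (sqr_ge0 t) t2; have k2 := ler_wpM2l (sqr_ge0 t) sw.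
  by move: k1 k2; rewrite /C; move: (M ^+ 2) (dot w (nu p)) (dot w v) (dot v v) (dot w w) (M * _);
    clear; move=> *; lra.
pose k := dot w (nu p).
have wk : w = k *: nu p.
  apply/eqP; rewrite -subr_eq0 -dot_eq0; apply/eqP.
  have h : dot (nu p) (w - k *: nu p) = 0.
    by rewrite dotDr dotNr dotZr nn mulr1 dotC subrr.
  by rewrite {1}dotDl dotNl dotZl h mulr0 subr0 perp.
have wn : enorm (z - p) = `|k|.
  by rewrite -wE wk enormZ /enorm nn sqrtr1 mulr1.
rewrite wn -wE {1}wk; congr (_ *: _).
have [k0|k0] := leP k 0; first by rewrite ler0_norm // opprK.
exfalso; have [r r0 h] : exists2 r : R, 0 < r & forall t, 0 < t -> t < r ->
    X (p - t *: nu p) /\ ~ X (p + t *: nu p).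
  have [r /= r0 h] := nX; exists r => // t t0 tr; apply: h => //=.
  by rewrite sub0r normrN gtr0_norm.
pose s := Num.min 1 (r / (2 * k)).
have s0 : 0 < s by rewrite lt_min ltr01 divr_gt0 // mulr_gt0.
have sk : s * k < r.
  apply: (@le_lt_trans _ _ (r / 2)); last by rewrite ltr_pdivrMr // mulr_natr mulr2n ltrDl.
  rewrite -ler_pdivlMr // ge_min; apply/orP; right.
  by rewrite le_eqVlt; apply/orP; left; apply/eqP; field; exact: lt0r_neq0.
have [_] := h (s * k) (mulr_gt0 s0 k0) sk; apply.
have -> : p + (s * k) *: nu p = z + (1 - s) *: (p - z).
  rewrite -scalerA -wk wE; apply/rowP => i; rewrite !mxE; ring.
apply: segment_to_nearest => //; first by rewrite subr_ge0 ge_min lexx.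
by rewrite ltrBlDr ltrDl.
Qed.

(** * First and second variation of a minimal link *)

Section Parabolas.
Context (R : realType) (n : nat).
Local Notation V := 'rV[R]_n.
Implicit Types (u v : V).

Lemma near_parabola_small u (E r : R) : 0 <= E -> 0 < r ->
  \forall t \near (0 : R), `|t| <= 1 /\
    forall x : V, enorm x <= E -> enorm (t *: u + t ^+ 2 *: x) < r.
Proof.
move=> E0 r0; have K0 : 0 < enorm u + E + 1.
  by rewrite ltr_wpDl // addr_ge0 // enorm_ge0.
apply/nbhs_ballP; exists (Num.min 1 (r / (enorm u + E + 1))) => /=.
  by rewrite lt_min ltr01 divr_gt0.
move=> t; rewrite -ball_normE /= sub0r normrN lt_min => /andP[t1].
rewrite ltr_pdivlMr // => tr; split; [exact: ltW|move=> x xE].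
apply: le_lt_trans tr; apply: (le_trans (enorm_triangle _ _)).
rewrite !enormZ normrX expr2 -mulrA -mulrDr ler_wpM2l // -addrA lerD2l.
apply: (@le_trans _ _ E); last by rewrite lerDl.
by rewrite (le_trans _ xE) // ler_piMl ?enorm_ge0 // ltW.
Qed.

Lemma dot_parabola_le u0 u1 u2 (t E : R) : `|t| <= 1 ->
    enorm u1 <= E -> enorm u2 <= E ->
  dot (u0 + t *: u1 + t ^+ 2 *: u2) (u0 + t *: u1 + t ^+ 2 *: u2) <=
    dot u0 u0 + t * (2 * dot u0 u1) + t ^+ 2 * (dot u1 u1 + 2 * dot u0 u2)
    + `|t| ^+ 3 * (3 * E ^+ 2).
Proof.
move=> t1 e1 e2; have E0 : 0 <= E by exact: le_trans (enorm_ge0 _) e1.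
rewrite !dot_lin (dotC u1 u0) (dotC u2 u0) (dotC u2 u1).
have h1 : t ^+ 3 * dot u1 u2 <= `|t| ^+ 3 * E ^+ 2.
  apply: (le_trans (ler_norm _)); rewrite normrM normrX ler_wpM2l ?exprn_ge0 //.
  by apply: (le_trans (dot_norm_le _ _)); rewrite expr2 ler_pM ?enorm_ge0.
have h2 : t ^+ 4 * dot u2 u2 <= `|t| ^+ 3 * E ^+ 2.
  apply: (le_trans (ler_norm _)); rewrite normrM normrX.
  have t43 : `|t| ^+ 4 <= `|t| ^+ 3.
    by rewrite [leLHS]exprS ler_piMl // exprn_ge0.
  apply: ler_pM; rewrite ?exprn_ge0 //.
  by rewrite ger0_norm ?dot_ge0 // -enorm_sqr ler_pXn2r ?nnegrE ?enorm_ge0.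
by move: h1 h2; clear; move: (dot u1 u2) (dot u2 u2) (`|t| ^+ 3) => *; lra.
Qed.

End Parabolas.

Section Variations.
Context (R : realType) (n : nat).
Local Notation V := 'rV[R]_n.
Implicit Types (X : set V) (z p q a b v : V) (tau d : R).

(** If z moves along b - a with the ends fixed, both halves shorten at the rate
    2 d (1 - a.b) in the square, which the penalty has to offset. *)
Lemma link_nearly_straight X z p q tau d a b :
    0 < d -> dot a a = 1 -> dot b b = 1 -> z - p = d *: a -> q - z = d *: b ->
    boundary X p -> boundary X q -> minimal_link X z p q tau ->
  d ^+ 2 * (1 - dot a b) <= 2 * (tau ^+ 2 * dot z z).
Proof.
move=> d0 aa bb zp qz bp bq [r r0 hmin].
have /linear_coef_eq0 : \forall t \near (0 : R),
    0 <= t * (2 * d * (dot a b - 1) + 2 * tau * dot z (b - a))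
      + t ^+ 2 * ((1 + tau) * dot (b - a) (b - a)).
  have := near_parabola_small (b - a) (lexx 0) r0; apply: filterS => t [_ /(_ 0)].
  rewrite enorm0 lexx scaler0 addr0 => /(_ isT) tr.
  have := hmin (z + t *: (b - a)) p q.
  rewrite [z + _]addrC addrK !subrr enorm0 => /(_ tr r0 r0 bp bq).
  have -> : t *: (b - a) + z - p = d *: a + t *: (b - a).
    by rewrite -zp; apply/rowP => i; rewrite !mxE; ring.
  have -> : t *: (b - a) + z - q = - (d *: b) + t *: (b - a).
    by rewrite -qz; apply/rowP => i; rewrite !mxE; ring.
  rewrite zp !dot_lin aa bb (dotC b a) (dotC b z) (dotC a z).
  set x := Num.max _ _; have xE : x = d ^+ 2 + t * (2 * d * (dot a b - 1))
      + t ^+ 2 * (2 - 2 * dot a b).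
    by rewrite /x; apply/eqP; rewrite eq_le ge_max le_max; apply/andP; split;
      [apply/andP; split|apply/orP; left]; rewrite le_eqVlt; apply/orP; left; apply/eqP; ring.
  by rewrite xE; move: (dot a b) (dot z a) (dot z b) (dot z z); clear; move=> *; lra.
move=> lin; have e : d * (1 - dot a b) = tau * dot z (b - a) by lra.
have ab : 0 <= 1 - dot a b.
  by have := dot_ge0 (b - a); rewrite !dot_lin aa bb (dotC b a); lra.
have [ab0|ab0] := eqVneq (1 - dot a b) 0.
  by rewrite ab0 mulr0 mulr_ge0 // mulr_ge0 ?sqr_ge0 ?dot_ge0.
have abp : 0 < 1 - dot a b by rewrite lt_neqAle eq_sym ab0.
rewrite -(ler_pM2r abp).
have -> : d ^+ 2 * (1 - dot a b) * (1 - dot a b) = (tau * dot z (b - a)) ^+ 2.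
  by rewrite -e; ring.
have ba : dot (b - a) (b - a) = 2 * (1 - dot a b).
  by rewrite !dot_lin aa bb (dotC b a); ring.
have := ler_wpM2l (sqr_ge0 tau) (cauchy_schwarz z (b - a)).
by rewrite ba exprMn; lra.
Qed.

(** The ends move along the boundary with initial velocities v and its
    transport, and z moves with the mean of the two velocities. The term of
    order t ^ 2 in the motion of z, along a + b, is chosen so that the two
    halves of the link have the same length up to second order. *)
Lemma link_second_variation X z p q tau d a b v (hp hq : R) (g := 1 + dot a b) :
    0 <= tau -> 0 < d -> 0 < g -> dot a a = 1 -> dot b b = 1 ->
    z - p = d *: a -> q - z = d *: b -> dot v v = 1 -> dot a v = 0 ->
    minimal_link X z p q tau ->
    (forall delta : R, 0 < delta -> \forall t \near (0 : R), exists s,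
      `|s - hp / 2| <= delta /\ boundary X (p + t *: v + (t ^+ 2 * s) *: a)) ->
    (forall delta : R, 0 < delta -> \forall t \near (0 : R), exists s,
      `|s - hq / 2| <= delta /\
      boundary X (q + t *: transport a b v - (t ^+ 2 * s) *: b)) ->
  d * (hp + hq) <= dot b v ^+ 2 / g + 2 * tau
    + tau * ((hp - hq) / g) * dot z (a + b).
Proof.
move=> tau0 d0 g0 aa bb zp qz vv av [r r0 hmin] hP hQ.
have gn0 : g != 0 by exact: lt0r_neq0.
pose e := a + b; have eE : e = a + b by [].
have ae : dot a e = g by rewrite eE dotDr aa.
have be : dot b e = g by rewrite eE dotDr bb (dotC b a) addrC.
have ee : dot e e = 2 * g by rewrite {1}eE dotDl ae be; ring.
pose B := dot b v; have ve : dot v e = B by rewrite eE dotDr (dotC v a) av add0r dotC.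
pose om := (hp - hq) / (4 * g).
(* v + m is the mean of v and its transport, and m half of their difference *)
pose m := - (B / (2 * g)) *: e; pose w := v + m.
have trE : transport a b v = v + 2 *: m.
  rewrite /transport -/g -/B -eE /m scalerA -scaleNr; congr (_ + _ *: _).
  by field.
have mm : dot m m = B ^+ 2 / (2 * g) by rewrite /m dotZl dotZr ee; field.
have am : dot a m = - (B / 2) by rewrite /m dotZr ae; field.
have bm : dot b m = - (B / 2) by rewrite /m dotZr be; field.
have ww : dot w w <= 1.
  rewrite /w dotDl !dotDr (dotC m v) vv mm /m dotZr ve.
  have : 0 <= B ^+ 2 / (2 * g) by rewrite divr_ge0 ?sqr_ge0 // mulr_ge0 // ltW.
  have -> : - (B / (2 * g)) * B = - (B ^+ 2 / (2 * g)) by field.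
  by move: (B ^+ 2 / _); clear; move=> *; lra.
clearbody m e.
have a1 : enorm a = 1 by rewrite /enorm aa sqrtr1.
have b1 : enorm b = 1 by rewrite /enorm bb sqrtr1.
(* a common bound for all velocities and second-order coefficients *)
pose E := enorm m + enorm w + enorm (om *: e) + `|hp / 2| + `|hq / 2| + 1
  + enorm v + enorm (v + 2 *: m).
have [Em [Ew [Ee [Ep Eq]]]] : enorm m <= E /\ enorm w <= E /\ enorm (om *: e) <= E /\
    enorm (om *: e) + (`|hp / 2| + 1) <= E /\ enorm (om *: e) + (`|hq / 2| + 1) <= E.
  have := enorm_ge0 m; have := enorm_ge0 w; have := enorm_ge0 (om *: e).
  have := enorm_ge0 v; have := enorm_ge0 (v + 2 *: m).
  have := normr_ge0 (hp / 2); have := normr_ge0 (hq / 2); rewrite /E.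
  move: (enorm m) (enorm w) (enorm (om *: e)) (`|hp / 2|) (`|hq / 2|) (enorm v) (enorm _).
  by clear; move=> *; do ![split]; lra.
have E0 : 0 <= E by exact: le_trans (enorm_ge0 _) Em.
pose K := B ^+ 2 / (2 * g) - d * (hp + hq) / 2
  + tau * (dot w w + 2 * om * dot z e).
have Kd (delta : R) : 0 < delta -> delta <= 1 -> 0 <= K + 2 * d * delta.
  move=> delta0 delta1.
  apply: (@quadratic_coef_ge0 _ (- d * B + 2 * tau * dot z w) _
    (3 * E ^+ 2 * (1 + tau))).
  have N1 := near_parabola_small w E0 r0.
  have N2 := near_parabola_small v E0 r0.
  have N3 := near_parabola_small (v + 2 *: m) E0 r0.
  apply: filterS3 (filterI N1 N2) (filterI N3 (hP _ delta0)) (hQ _ delta0).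
  move=> t [[t1 tw] [_ tv]] [[_ tm] [s [sb bs]]] [s' [sb' bs']].
  have sE : `|s| <= `|hp / 2| + 1.
    by rewrite -[s](subrK (hp / 2)) addrC (le_trans (ler_normD _ _)) // lerD2l (le_trans sb).
  have s'E : `|s'| <= `|hq / 2| + 1.
    by rewrite -[s'](subrK (hq / 2)) addrC (le_trans (ler_normD _ _)) // lerD2l (le_trans sb').
  have oe0 := enorm_ge0 (om *: e).
  have saE : enorm (s *: a) <= E.
    by rewrite enormZ a1 mulr1 (le_trans sE) // (le_trans _ Ep) // lerDr.
  have sbE : enorm (- (s' *: b)) <= E.
    by rewrite enormN enormZ b1 mulr1 (le_trans s'E) // (le_trans _ Eq) // lerDr.
  pose zh := z + (t *: w + t ^+ 2 *: (om *: e)).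
  pose ph := p + t *: v + (t ^+ 2 * s) *: a.
  pose qh := q + t *: transport a b v - (t ^+ 2 * s') *: b.
  have zhr : enorm (zh - z) < r by rewrite /zh addrC addKr; exact: tw.
  have phr : enorm (ph - p) < r.
    rewrite (_ : ph - p = t *: v + t ^+ 2 *: (s *: a)); first exact: tv.
    by rewrite /ph; apply/rowP => i; rewrite !mxE; ring.
  have qhr : enorm (qh - q) < r.
    rewrite (_ : qh - q = t *: (v + 2 *: m) + t ^+ 2 *: (- (s' *: b))); first exact: tm.
    by rewrite /qh trE; apply/rowP => i; rewrite !mxE; ring.
  have := hmin zh ph qh zhr phr qhr bs bs'.
  have zpE : zh - ph = d *: a + t *: m + t ^+ 2 *: (om *: e - s *: a).
    by rewrite -zp /zh /ph /w; apply/rowP => i; rewrite !mxE; ring.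
  have zqE : zh - qh = - (d *: b) + t *: (- m) + t ^+ 2 *: (om *: e + s' *: b).
    by rewrite -qz /zh /qh trE /w; apply/rowP => i; rewrite !mxE; ring.
  have xE : enorm (om *: e - s *: a) <= E.
    rewrite (le_trans (enorm_triangle _ _)) // (le_trans _ Ep) // lerD2l.
    by rewrite enormN enormZ a1 mulr1.
  have yE : enorm (om *: e + s' *: b) <= E.
    rewrite (le_trans (enorm_triangle _ _)) // (le_trans _ Eq) // lerD2l.
    by rewrite enormZ b1 mulr1.
  have mE : enorm (- m) <= E by rewrite enormN.
  have P1 := dot_parabola_le (d *: a) t1 Em xE.
  have P2 := dot_parabola_le (- (d *: b)) t1 mE yE.
  have P3 := dot_parabola_le z t1 Ew Ee.
  rewrite -zpE in P1; rewrite -zqE in P2; rewrite -addrA -/zh in P3.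
  have omg : om * g = (hp - hq) / 4 by rewrite /om; field.
  have P1' : dot (zh - ph) (zh - ph) <= d ^+ 2 - t * (d * B)
      + t ^+ 2 * (B ^+ 2 / (2 * g) - d * (hp + hq) / 2 + 2 * d * delta)
      + `|t| ^+ 3 * (3 * E ^+ 2).
    apply: (le_trans P1); rewrite lerD2r.
    rewrite !dotZl !(dotDr, dotZr, dotNr) aa am ae omg mm.
    have -> : d * (d * 1) + t * (2 * (d * - (B / 2))) = d ^+ 2 - t * (d * B) by field.
    rewrite lerD2l ler_wpM2l ?sqr_ge0 //.
    have : d * (hp / 2 - s) <= d * delta.
      by rewrite ler_wpM2l ?(ltW d0) // (le_trans _ sb) // distrC ler_norm.
    by move: (B ^+ 2 / _); clear; move=> *; lra.
  have P2' : dot (zh - qh) (zh - qh) <= d ^+ 2 - t * (d * B)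
      + t ^+ 2 * (B ^+ 2 / (2 * g) - d * (hp + hq) / 2 + 2 * d * delta)
      + `|t| ^+ 3 * (3 * E ^+ 2).
    apply: (le_trans P2); rewrite lerD2r.
    rewrite !(dotNl, dotNr, opprK) !dotZl !(dotDr, dotZr, dotNr) bb bm be omg mm.
    have -> : d * (d * 1) + t * (2 * (d * - (B / 2))) = d ^+ 2 - t * (d * B) by field.
    rewrite lerD2l ler_wpM2l ?sqr_ge0 //.
    have : d * (hq / 2 - s') <= d * delta.
      by rewrite ler_wpM2l ?(ltW d0) // (le_trans _ sb') // distrC ler_norm.
    by move: (B ^+ 2 / _); clear; move=> *; lra.
  have P3' := ler_wpM2l tau0 P3.
  have dd : dot (z - p) (z - p) = d ^+ 2 by rewrite zp dotZl dotZr aa; ring.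
  set mx := Num.max _ _; have mxE : mx <= d ^+ 2 - t * (d * B)
      + t ^+ 2 * (B ^+ 2 / (2 * g) - d * (hp + hq) / 2 + 2 * d * delta)
      + `|t| ^+ 3 * (3 * E ^+ 2) by rewrite /mx ge_max P1' P2'.
  rewrite dd; move: P3' mxE; rewrite dotZr /K.
  move: mx (dot zh zh) (dot z z) (dot z w) (dot w w) (dot z e) (`|t| ^+ 3) (B ^+ 2 / (2 * g)).
  by clear; move=> *; lra.
have K0 : 0 <= K.
  have dd0 : 0 < 2 * d by rewrite mulr_gt0.
  apply/ler_addgt0Pl => eps eps0.
  pose delta := Num.min 1 (eps / (2 * d)).
  have del0 : 0 < delta by rewrite lt_min ltr01 divr_gt0.
  have del1 : delta <= 1 by rewrite ge_min lexx.
  apply: le_trans (Kd _ del0 del1) _; rewrite addrC lerD2r mulrC.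
  by rewrite -ler_pdivlMr // ge_min lexx orbT.
have tw : tau * dot w w <= tau by rewrite -[leRHS]mulr1 ler_wpM2l.
have -> : dot b v ^+ 2 / g = 2 * (B ^+ 2 / (2 * g)) by rewrite /B; field.
have -> : tau * ((hp - hq) / g) * dot z (a + b) = 2 * (tau * (2 * om * dot z e)).
  by rewrite -eE /om; field.
move: K0 tw; rewrite /K; move: (B ^+ 2 / (2 * g)) (2 * om * dot z e) (dot w w).
by clear; move=> *; lra.
Qed.

End Variations.

(** Summing the second variation over an orthonormal frame at p and its
    transport to q turns the second fundamental forms into mean curvatures. *)
Lemma link_curvature_bound (R : realType) (n : nat) (X : set 'rV[R]_n) nu z p q
    (tau d c : R) :
    C2_domain X -> outward_unit_normal X nu -> X z ->
    boundary X p -> boundary X q -> 0 < d -> enorm (z - p) = d -> enorm (z - q) = d ->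
    (forall y, boundary X y -> d <= enorm (z - y)) ->
    0 <= tau -> 4 * (tau * enorm z) <= d -> minimal_link X z p q tau ->
    0 <= c -> c <= mean_curvature (boundary X) nu p ->
    0 <= mean_curvature (boundary X) nu q ->
  c * d ^+ 3 <= 4 * (tau ^+ 2 * dot z z) + 4 * n.-1%:R * tau * d ^+ 2.
Proof.
move=> X2 nuX Xz bp bq d0 zpd zqd near_d tau0 tz hmin c0 cp q0.
have [a aE] : exists a, a = - nu p by exists (- nu p).
have [b bE] : exists b, b = nu q by exists (nu q).
have zp : z - p = d *: a.
  rewrite aE scalerN -scaleNr -zpd; apply: (nearest_normal X2 nuX Xz bp).
  by rewrite zpd.
have qz : q - z = d *: b.
  apply: oppr_inj; rewrite bE opprB -scaleNr -zqd.
  by apply: (nearest_normal X2 nuX Xz bq); rewrite zqd.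
have pp : dot (nu p) (nu p) = 1 by case: (nuX p bp).
have bb : dot b b = 1 by rewrite bE; case: (nuX q bq).
have aa : dot a a = 1 by rewrite aE !dot_lin opprK.
have straight := link_nearly_straight d0 aa bb zp qz bp bq hmin.
have tz2 : tau ^+ 2 * dot z z <= d ^+ 2 / 16.
  have : (4 * (tau * enorm z)) ^+ 2 <= d ^+ 2.
    by rewrite ler_pXn2r ?nnegrE ?mulr_ge0 ?enorm_ge0 // ltW.
  by rewrite !exprMn enorm_sqr; lra.
have dd : 0 < d ^+ 2 by rewrite exprn_gt0.
(* the link is nearly straight, so that a + b is far from zero *)
have ab : 1 - dot a b <= 1 / 8.
  by rewrite -(ler_pM2l dd); move: straight tz2; clear; lra.
pose g := 1 + dot a b.
have g1 : 1 <= g by move: ab; rewrite /g; clear; lra.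
have g0 : 0 < g by exact: lt_le_trans g1.
have gn0 : g != 0 by exact: lt0r_neq0.
have [e fe] := normal_frame_exists pp.
have fa : normal_frame a e.
  by case: fe => ee en; split => // i; rewrite aE dotNr en oppr0.
have fb : normal_frame b (transport a b \o e).
  exact: transport_frame.
have [Qp [trp hp]] := boundary_second_order X2 nuX bp.
have [Qq [trq hq]] := boundary_second_order X2 nuX bq.
rewrite -bE in trq hq; rewrite (trp _ fe) in cp; rewrite (trq _ fb) in q0.
pose hpi i := dot (e i *m Qp) (e i).
pose hqi i := dot (transport a b (e i) *m Qq) (transport a b (e i)).
pose T := tau / g * dot z (a + b).
have var i : d * (hpi i + hqi i) <=
    dot b (e i) ^+ 2 / g + 2 * tau + T * (hpi i - hqi i).
  have [ee en] := fa.
  have ae : dot a (e i) = 0 by rewrite dotC en.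
  have -> : T * (hpi i - hqi i) = tau * ((hpi i - hqi i) / g) * dot z (a + b).
    by rewrite /T; ring.
  apply: (link_second_variation tau0 d0 g0 aa bb zp qz _ ae hmin).
  - by rewrite ee eqxx.
  - move=> delta del0; have pe : dot (nu p) (e i) = 0 by rewrite dotC; case: fe.
    apply: filterS (hp _ pe _ del0) => t [s [sb bs]]; exists s; split; first exact: sb.
    by rewrite aE scalerN.
  - by move=> delta del0; apply: hq => //; exact: transport_orthogonal.
have sum_var : d * (\sum_i hpi i + \sum_i hqi i) <=
    (1 - dot a b) + 2 * tau * n.-1%:R + T * (\sum_i hpi i - \sum_i hqi i).
  have -> : 1 - dot a b = (\sum_i dot b (e i) ^+ 2) / g.
    by rewrite (normal_frame_parseval b aa fa) bb (dotC b a) /g; field.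
  have -> : 2 * tau * n.-1%:R = \sum_(i < n.-1) 2 * tau.
    by rewrite sumr_const card_ord mulr_natr.
  rewrite -sumrB -big_split /= mulr_suml !mulr_sumr -!big_split /=.
  exact: ler_sum.
have T2 : T ^+ 2 <= (d / 2) ^+ 2.
  have h := ler_wpM2l (sqr_ge0 (tau / g)) (cauchy_schwarz z (a + b)).
  have abab : dot (a + b) (a + b) = 2 * g by rewrite !dot_lin aa bb (dotC b a) /g; ring.
  rewrite /T exprMn (le_trans h) // abab.
  have -> : (tau / g) ^+ 2 * (dot z z * (2 * g)) = 2 * (tau ^+ 2 * dot z z) / g by field.
  rewrite ler_pdivrMr //; have := ler_wpM2l (ltW dd) g1.
  by move: tz2 dd; clear; move: (tau ^+ 2 * _) => *; lra.
have Td : `|T| <= d / 2.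
  by rewrite -(@ler_pXn2r _ 2%N) ?nnegrE ?divr_ge0 ?(ltW d0) // real_normK ?num_real.
move: Td; rewrite ler_norml => /andP[Tm Tp].
have cp' : c <= \sum_i hpi i by exact: cp.
have q0' : 0 <= \sum_i hqi i by exact: q0.
(* the weights d - T and d + T of the two mean curvatures are at least d / 2 *)
have key : d / 2 * c <= (1 - dot a b) + 2 * tau * n.-1%:R.
  have k1 : d / 2 * c <= (d - T) * \sum_i hpi i.
    by apply: ler_pM => //; rewrite ?divr_ge0 ?(ltW d0) //; move: Tp; clear; lra.
  have k2 : 0 <= (d + T) * \sum_i hqi i.
    by apply: mulr_ge0 => //; move: Tm d0; clear; lra.
  by move: sum_var k1 k2; move: (\sum_i hpi i) (\sum_i hqi i) (dot a b); clear; move=> *; lra.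
have := ler_wpM2l (ltW dd) key.
by move: straight; move: (dot a b) (tau ^+ 2 * _); clear; move=> *; lra.
Qed.

(** * The theorem *)

Section Contradiction.
Context (R : realType) (n : nat).
Local Notation V := 'rV[R]_n.
Implicit Types (X S : set V).

(** On the equidistant set let u be the distance to S, let z minimise
    sqrt u + eps |z|^2, and put d = u z. As t -> t^4 is convex, z also minimises
    u^2 + tau |z|^2 for tau = 4 eps d^(3/2), and the curvature bound divided by
    d^3 reads c <= eps (64 + 16 (n - 1)) K, where K bounds sqrt d and eps |z|^2
    independently of eps. The square root matters: it gives tau the power of d
    that survives the division by d^3 even if d tends to 0 with eps. *)
Lemma mean_curvature_not_bounded_below X nu S S' (c : R) :
    C2_domain X -> connected X -> outward_unit_normal X nu ->
    closed S -> closed S' -> S !=set0 -> S' !=set0 ->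
    (forall y, S y -> S' y -> False) ->
    (forall y, boundary X y <-> S y \/ S' y) -> 0 < c ->
    (forall y, S y -> c <= mean_curvature (boundary X) nu y) ->
    (forall y, S' y -> 0 <= mean_curvature (boundary X) nu y) ->
  False.
Proof.
move=> X2 cX nuX cS cS' S0 S'0 SS' bX c0 HS HS'; have oX : open X by case: X2.
have [z0 Mz0] := equidistant_nonempty cS cS' S0 S'0 SS' bX cX.
have cM := @equidistant_closed _ _ X _ _ cS cS' S0 S'0.
have Mpos z : equidistant X S S' z -> X z /\ 0 < edist S z.
  by move=> Mz; exact: (equidistant_interior oX cS cS' S0 S'0 SS' bX Mz).
pose K := Num.sqrt (edist S z0) + dot z0 z0.
have K0 : 0 < K.
  by rewrite ltr_wpDr ?dot_ge0 // sqrtr_gt0; case: (Mpos _ Mz0).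
pose N := 64 * K + 16 * n.-1%:R * K.
have N0 : 0 < N by rewrite ltr_wpDr ?mulr_gt0 // mulr_ge0 // ?mulr_ge0 // ltW.
(* the condition with K ^ 3 ensures 4 tau |z| <= d, the one with N contradicts c *)
have [eps [eps0 eps1 epsK epsN]] : exists eps : R, [/\ 0 < eps, eps <= 1,
    eps * (256 * K ^+ 3) <= 1 & eps * N <= c / 2].
  have K3 : 0 < 256 * K ^+ 3 by apply: mulr_gt0; [rewrite ltr0n|exact: exprn_gt0].
  exists (Num.min 1 (Num.min (1 / (256 * K ^+ 3)) (c / 2 / N))); split.
  - by rewrite !lt_min ltr01 !divr_gt0.
  - by rewrite ge_min lexx.
  - by rewrite -ler_pdivlMr // !ge_min lexx orbT.
  - by rewrite -ler_pdivlMr // !ge_min lexx !orbT.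
pose phi z := Num.sqrt (edist S z) + eps * dot z z.
have phic : continuous phi.
  move=> z; apply: (@cvgD _ _ _ (nbhs z)).
    exact: (continuous_comp (continuous_edist cS S0 (x := z)) (@sqrt_continuous R _)).
  apply: (@cvgM _ _ (nbhs z)); first exact: cvg_cst.
  by apply: (@continuous_dot _ _ V id id z); exact (@cvg_id _ (nbhs z)).
have phi0 : phi z0 <= K by rewrite /phi lerD2l ler_piMl // dot_ge0.
have [|z Mz zmin] := closed_min cM Mz0 phic.
  apply: (@enorm_ball_bounded _ _ 0 (Num.sqrt (K / eps))) => z [_ zz].
  rewrite subr0 /enorm ler_wsqrtr // ler_pdivlMr // mulrC.
  apply: le_trans phi0; apply: le_trans zz.
  by rewrite /phi lerDr sqrtr_ge0.
have [Xz d0] := Mpos z Mz; set d := edist S z in d0 *.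
pose r := Num.sqrt d; have r0 : 0 < r by rewrite sqrtr_gt0.
have dE : d = r ^+ 2 by rewrite sqr_sqrtr // ltW.
have zK : r + eps * dot z z <= K by apply: le_trans phi0; exact: zmin.
have zz0 := dot_ge0 z.
have rK : r <= K by apply: le_trans zK; rewrite lerDl mulr_ge0 // ltW.
have ezK : eps * dot z z <= K by apply: le_trans zK; rewrite lerDr ltW.
pose tau := 4 * eps * r ^+ 3.
have tau0 : 0 <= tau by rewrite !mulr_ge0 ?exprn_ge0 // ltW.
have taumin w : equidistant X S S' w ->
    d ^+ 2 + tau * dot z z <= edist S w ^+ 2 + tau * dot w w.
  move=> Mw; have := zmin w Mw; rewrite /phi -/d -/r.
  have -> : edist S w = Num.sqrt (edist S w) ^+ 2 by rewrite sqr_sqrtr // edist_ge0.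
  rewrite sqrtr_sqr ger0_norm ?sqrtr_ge0 // dE /tau.
  have := sqrtr_ge0 (edist S w); move: (Num.sqrt (edist S w)) (dot z z) (dot w w) => y A B y0 h.
  have convex : r ^+ 4 + 4 * r ^+ 3 * (y - r) <= y ^+ 4.
    rewrite -subr_ge0 (_ : _ - _ = (y - r) ^+ 2 * (y ^+ 2 + 2 * y * r + 3 * r ^+ 2)); last by ring.
    by rewrite mulr_ge0 ?sqr_ge0 // !addr_ge0 // ?mulr_ge0 ?sqr_ge0 // ltW.
  have r3 : 0 <= 4 * r ^+ 3 by rewrite mulr_ge0 // exprn_ge0 // ltW.
  have h' : eps * (A - B) <= y - r by move: h; clear; lra.
  by have := ler_wpM2l r3 h'; move: convex; clear; lra.
have tz : 4 * (tau * enorm z) <= d.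
  have k1 : (16 * (eps * r * enorm z)) ^+ 2 <= 1.
    rewrite !exprMn enorm_sqr; apply: le_trans epsK.
    have h : r ^+ 2 * (eps * dot z z) <= K ^+ 2 * K.
      apply: ler_pM => //; rewrite ?sqr_ge0 ?mulr_ge0 ?(ltW eps0) //.
      by rewrite ler_pXn2r ?nnegrE ?(ltW r0) ?(ltW K0).
    by have := ler_wpM2l (ltW eps0) h; clear; lra.
  have k2 : 16 * (eps * r * enorm z) <= 1.
    by rewrite -(@ler_pXn2r _ 2%N) ?nnegrE ?expr1n // !mulr_ge0 ?enorm_ge0 // ltW.
  have := ler_wpM2l (sqr_ge0 r) k2; rewrite dE /tau; clear; lra.
have [p Sp zp] := edist_attained z cS S0.
have [q S'q zq] := edist_attained z cS' S'0.
have de : edist S' z = d by case: Mz.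
rewrite de in zq.
have bp : boundary X p by apply/bX; left.
have bq : boundary X q by apply/bX; right.
have near_d y : boundary X y -> d <= enorm (z - y).
  by move=> /bX[Sy|S'y]; [exact: edist_le|rewrite -de; exact: edist_le].
have link := equidistant_min_link oX cS cS' S0 S'0 SS' bX Mz Sp (esym zp) S'q (esym zq)
  tau0 tz taumin.
have := link_curvature_bound X2 nuX Xz bp bq d0 (esym zp) (esym zq) near_d tau0 tz link
  (ltW c0) (HS p Sp) (HS' q S'q).
apply/negP; rewrite -ltNge dE /tau.
have r6 : 0 < r ^+ 6 by rewrite exprn_gt0.
have nK : 16 * n.-1%:R * (eps * r) <= 16 * n.-1%:R * (eps * K).
  by rewrite ler_wpM2l ?mulr_ge0 // ler_wpM2l // ltW.
have eK : 64 * (eps * (eps * dot z z)) <= 64 * (eps * K).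
  by rewrite ler_wpM2l // ler_wpM2l // ltW.
have fin : 64 * (eps * (eps * dot z z)) + 16 * n.-1%:R * (eps * r) < c.
  by move: nK eK epsN c0; rewrite /N; move: (n.-1%:R) (dot z z); clear; move=> *; lra.
move: fin; rewrite -(ltr_pM2l r6); move: (n.-1%:R) (dot z z); clear; move=> *; lra.
Qed.

End Contradiction.

Theorem theorem1p2 (R : realType) (n : nat)
    (X : set 'rV[R]_n) (nu : 'rV[R]_n -> 'rV[R]_n)
    (X_C2 : C2_domain X) (X_connected : connected X)
    (X_unbounded : ~ bounded_set X)
    (nu_normal : outward_unit_normal X nu)
    (X_mean_convex :
      forall p, boundary X p -> 0 <= mean_curvature (boundary X) nu p)
    (bX_disconnected : ~ connected (boundary X)) :
  (forall Sigma : set 'rV[R]_n, is_component (boundary X) Sigma ->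
    ereal_inf [set (mean_curvature (boundary X) nu p)%:E | p in Sigma] = 0%E)
  /\
  ~ (exists (Sigma : set 'rV[R]_n) (c : R),
      [/\ is_component (boundary X) Sigma, 0 < c &
          forall p, Sigma p -> c <= mean_curvature (boundary X) nu p]).
Proof.
(* a positive infimum of H over Sigma would itself be a bound c *)
have noc : ~ (exists (Sigma : set 'rV[R]_n) (c : R),
    [/\ is_component (boundary X) Sigma, 0 < c &
        forall p, Sigma p -> c <= mean_curvature (boundary X) nu p]).
  move=> [Sigma [c [[p0 bp0 SE] c0 HS]]].
  have Sb : Sigma `<=` boundary X by rewrite SE; exact: connected_component_sub.
  pose S' := boundary X `\` Sigma.
  have S'0 : S' !=set0.
    apply/set0P/eqP => S'0; apply: bX_disconnected.
    have <- : Sigma = boundary X; last by rewrite SE; exact: component_connected.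
    apply/seteqP; split => // y by_; apply: contrapT => nS.
    have : S' y by split.
    by rewrite S'0.
  apply: (@mean_curvature_not_bounded_below _ _ X nu Sigma S' c) => //.
  - by rewrite SE; apply: component_closed; exact: closed_boundary.
  - by rewrite /S' SE; exact: boundary_component_complement_closed.
  - by exists p0; rewrite SE; exact: connected_component_refl.
  - by move=> y Sy [_]; exact.
  - move=> y; split=> [by_|[/Sb //|[//]]].
    by have [|nS] := pselect (Sigma y); [left|right].
  - by move=> y [by_ _]; exact: X_mean_convex.
split => // Sigma compS; have [p0 bp0 SE] := compS.
set A := [set _ | _ in _]; have A0 : (0%:E <= ereal_inf A)%E.
  apply: le_ereal_inf_tmp => _ [p Sp <-]; rewrite lee_fin; apply: X_mean_convex.
  by move: Sp; rewrite SE; exact: connected_component_sub.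
have Ap p : Sigma p -> (ereal_inf A <= (mean_curvature (boundary X) nu p)%:E)%E.
  by move=> Sp; apply: ereal_inf_lbound; exists p.
have Sp0 : Sigma p0 by rewrite SE; exact: connected_component_refl.
have := Ap p0 Sp0; case E : (ereal_inf A) A0 => [c| |] //.
rewrite lee_fin le_eqVlt => /orP[/eqP <- //|c0] _.
exfalso; apply: noc; exists Sigma, c; split => // p Sp.
by rewrite -lee_fin -E; exact: Ap.
Qed.
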